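(* Let $X$ be a Banach space with the Gaussian average property $\mathrm{GAP}$. Then there is a constant $K$ so that for every subspace $E\subseteq X$ and every $T\in\ell_2\otimes E$ we have $$\pi_1(T^* )\le K\pi_1(T^*Q),$$ where $Q$ is the canonical quotient map of $X^*$ onto $E^*$. Consequently, every $S\in\Gamma_1(E,\ell_2)$ admits an extension $\widetilde{S}\in\Gamma_1(X,\ell_2)$ with $\gamma_1(\widetilde{S})\le K\gamma_1(S)$.
   Context: Subspaces are closed linear subspaces. $\pi_1$ denotes the 1-summing norm. For a Banach space $Z$, $\ell_2\otimes Z$ is identified with the finite rank operators from $\ell_2$ to $Z$. $(g_n)$ is a sequence of independent standard Gaussian variables on a probability space $(\Omega,\mathcal{S},\mu)$ and $(e_n)$ is the unit vector basis of $\ell_2$. For $T\in \ell_2\otimes Z$ the $\ell$-norm is $\ell(T)=\left(\int\|\sum_{n=1}^\infty g_n(t)Te_n\|^2d\mu(t)\right)^{1/2}$ (the series converges in $L_2(\mu,Z)$). $Z$ has $\mathrm{GAP}$ if there is a constant $K$ so that $\ell(T)\le K\pi_1(T^* )$ for all $T\in\ell_2\otimes Z$. $\Gamma_1(Z,Y)$ is the space of operators $T:Z\to Y$ which factor as $T=BA$ with $A: Z\to L_1(\nu)$, $B:L_1(\nu)\to Y$ bounded for some measure $\nu$, with norm $\gamma_1(T)=\inf\|A\|\|B\|$ over all such factorizations. *)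

(* Defs.v *)
From HB Require Import structures.
From mathcomp Require Import all_boot all_order all_algebra.
From mathcomp Require Import all_classical all_reals all_analysis.
From mathcomp Require Import measurable_realfun.
Set Implicit Arguments.
Unset Strict Implicit.
Unset Printing Implicit Defensive.
Import Order.TTheory GRing.Theory Num.Theory.
Import numFieldNormedType.Exports.
Local Open Scope classical_set_scope.
Local Open Scope ring_scope.

Section bounded_operators.
Context (R : realType) (V W : normedModType R).

Definition is_bop : {pred V -> W} :=
  mem [set f : V -> W | linear f /\ continuous f].

Lemma is_bop_submod_closed : submod_closed is_bop.
Proof.
split.
  by rewrite inE; split=> [a x y|x]; [rewrite scaler0 addr0 | exact: cvg_cst].
move=> a f h; rewrite !inE => -[lf cf] [lh ch]; split.
  move=> b x y.
  rewrite !fctE lf lh !scalerDr !scalerA (mulrC a b).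
  by rewrite !addrA; congr (_ + _); rewrite -!addrA; congr (_ + _); rewrite addrC.
by move=> x; apply: cvgD; [apply: cvgZl_tmp; exact: cf | exact: ch].
Qed.

HB.instance Definition _ :=
  GRing.isSubmodClosed.Build R (V -> W) is_bop is_bop_submod_closed.

Record bop := Bop { bop_fun :> V -> W ; _ : bop_fun \in is_bop }.

HB.instance Definition _ := [isSub for bop_fun].
HB.instance Definition _ := [Choice of bop by <:].
HB.instance Definition _ := [SubChoice_isSubLmodule of bop by <:].

Lemma bopP (f : bop) : linear f /\ continuous f.
Proof. by have := valP f; rewrite inE. Qed.

Lemma bop_linear (f : bop) : linear f. Proof. exact: (bopP f).1. Qed.

HB.instance Definition _ (f : bop) :=
  GRing.isLinear.Build R V W *:%R f (bop_linear f).

Lemma mem_bop (f : {linear V -> W}) (M : R) :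
  (forall x, `|f x| <= M * `|x|) -> (f : V -> W) \in is_bop.
Proof.
move=> fM; rewrite inE; split; first by move=> a x y; rewrite linearP.
apply/linear_bounded_continuous/linear_boundedP.
near=> r => x; by apply: (le_trans (fM x)); rewrite ler_wpM2r.
Unshelve. all: by end_near. Qed.

Definition opnorm (f : bop) : R :=
  sup [set `|f x| | x in [set x : V | `|x| <= 1]].

Lemma opnorm_has_sup (f : bop) :
  has_sup [set `|f x| | x in [set x : V | `|x| <= 1]].
Proof.
split; first by exists `|f 0|, 0; rewrite //= normr0.
have /linear_bounded_continuous/linear_boundedP/pinfty_ex_gt0[M M0 fM] :=
  (bopP f).2.
exists M => _ [x /= x1 <-]; apply: (le_trans (fM x)).
by rewrite ler_piMr// ltW.
Qed.

Lemma opnorm_ge0 (f : bop) : 0 <= opnorm f.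
Proof.
apply: (@le_trans _ _ `|f 0|) => //; apply: ub_le_sup.
  exact: (opnorm_has_sup f).2.
by exists 0; rewrite //= normr0.
Qed.

Lemma ler_opnorm (f : bop) x : `|f x| <= opnorm f * `|x|.
Proof.
have [->|x0] := eqVneq x 0; first by rewrite linear0 !normr0 mulr0.
rewrite -ler_pdivrMr ?normr_gt0//.
have -> : `|f x| / `|x| = `|f (`|x|^-1 *: x)|.
  by rewrite linearZ normrZ normfV normr_id mulrC.
apply: ub_le_sup; first exact: (opnorm_has_sup f).2.
exists (`|x|^-1 *: x) => //=.
by rewrite normrZ normfV normr_id mulVf// normr_eq0.
Qed.

Lemma opnorm_le (f : bop) M : 0 <= M ->
  (forall x, `|f x| <= M * `|x|) -> opnorm f <= M.
Proof.
move=> M0 fM; apply: ge_sup; first exact: (opnorm_has_sup f).1.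
by move=> _ [x /= x1 <-]; apply: (le_trans (fM x)); rewrite ler_piMr.
Qed.

Lemma ler_opnormD (f h : bop) : opnorm (f + h) <= opnorm f + opnorm h.
Proof.
apply: opnorm_le => [|x]; first by rewrite addr_ge0 ?opnorm_ge0.
by rewrite (le_trans (ler_normD _ _))// mulrDl lerD ?ler_opnorm.
Qed.

Lemma opnormZ_le (a : R) (f : bop) : opnorm (a *: f) <= `|a| * opnorm f.
Proof.
apply: opnorm_le => [|x]; first by rewrite mulr_ge0 ?opnorm_ge0.
rewrite -[(a *: f) x]/(a *: f x) normrZ -mulrA.
by rewrite ler_wpM2l// ler_opnorm.
Qed.

Lemma opnormZ (a : R) (f : bop) : opnorm (a *: f) = `|a| * opnorm f.
Proof.
apply/eqP; rewrite eq_le opnormZ_le/=.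
have [->|a0] := eqVneq a 0; first by rewrite normr0 mul0r opnorm_ge0.
rewrite -ler_pdivlMl ?normr_gt0// -normfV.
by apply: le_trans (opnormZ_le _ _); rewrite scalerA mulVf// scale1r.
Qed.

Lemma opnorm0_eq0 (f : bop) : opnorm f = 0 -> f = 0.
Proof.
move=> f0; apply/val_inj/funext => x; apply/eqP.
by rewrite -normr_le0 (le_trans (ler_opnorm f x))// f0 mul0r.
Qed.

HB.instance Definition _ :=
  @Lmodule_isNormed.Build R bop opnorm ler_opnormD opnormZ opnorm0_eq0.

End bounded_operators.

Notation "V '->b' W" := (bop V W) (at level 99, right associativity).

Definition dual (R : realType) (V : normedModType R) : normedModType R :=
  V ->b R^o.

Section composition.
Context (R : realType) (U V W : normedModType R).

Lemma bop_comp_subproof (f : V ->b W) (h : U ->b V) :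
  (f \o h : U -> W) \in @is_bop R U W.
Proof.
rewrite inE; split; first by move=> a x y /=; rewrite !linearP.
move=> x; apply: continuous_comp; first exact: (bopP h).2.
exact: (bopP f).2.
Qed.

Definition bop_comp (f : V ->b W) (h : U ->b V) : U ->b W :=
  Bop (bop_comp_subproof f h).
End composition.

Section adjoint.
Context (R : realType) (V W : normedModType R) (T : V ->b W).

Definition adjoint_fun (f : dual W) : dual V := bop_comp f T.

Lemma adjoint_fun_linear : linear adjoint_fun.
Proof. by move=> a f h; apply/val_inj/funext. Qed.

HB.instance Definition _ :=
  GRing.isLinear.Build R (dual W) (dual V) *:%R adjoint_fun adjoint_fun_linear.

Lemma adjoint_subproof :
  (adjoint_fun : dual W -> dual V) \in @is_bop R (dual W) (dual V).
Proof.
apply: (@mem_bop _ _ _ adjoint_fun `|T|) => f; apply: opnorm_le => [|x].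
  by rewrite mulr_ge0.
rewrite -mulrA mulrCA; apply: (le_trans (ler_opnorm f (T x))).
by apply: ler_wpM2l; [exact: opnorm_ge0 | exact: ler_opnorm].
Qed.

Definition adjoint : dual W ->b dual V := Bop adjoint_subproof.
End adjoint.

Section subspace.
Context (R : realType) (X : normedModType R) (E : submodClosed X).

Record subsp := Subsp { subsp_val :> X ; _ : subsp_val \in E }.

HB.instance Definition _ := [isSub for subsp_val].
HB.instance Definition _ := [Choice of subsp by <:].
HB.instance Definition _ := [SubChoice_isSubLmodule of subsp by <:].

Definition subsp_norm (x : subsp) : R := `|val x|.

Lemma ler_subsp_normD x y : subsp_norm (x + y) <= subsp_norm x + subsp_norm y.
Proof. exact: ler_normD. Qed.

Lemma subsp_normZ (a : R) x : subsp_norm (a *: x) = `|a| * subsp_norm x.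
Proof. exact: normrZ. Qed.

Lemma subsp_norm0_eq0 x : subsp_norm x = 0 -> x = 0.
Proof. by move=> /normr0_eq0 x0; apply: val_inj. Qed.

HB.instance Definition _ := @Lmodule_isNormed.Build R subsp subsp_norm
  ler_subsp_normD subsp_normZ subsp_norm0_eq0.

Lemma subsp_val_linear : linear subsp_val. Proof. by []. Qed.

HB.instance Definition _ :=
  GRing.isLinear.Build R subsp X *:%R subsp_val subsp_val_linear.

Lemma incl_subproof : (subsp_val : subsp -> X) \in @is_bop R subsp X.
Proof. by apply: (@mem_bop _ _ _ subsp_val 1) => x; rewrite mul1r. Qed.

Definition incl : subsp ->b X := Bop incl_subproof.

(* The adjoint of the inclusion: restriction of functionals from X to E. *)
Definition quotient_map : dual X ->b dual subsp := adjoint incl.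
End subspace.

(* Square-summable real sequences; functions equal almost everywhere for the
   counting measure are equal, so no quotient is needed. *)
Definition ell2 (R : realType) := LfunType (@counting nat R) (lee1n 2).

Section ell2.
Context (R : realType).
Local Notation ell2 := (ell2 R).

HB.instance Definition _ := GRing.Lmodule.on ell2.

Definition ell2_norm (u : ell2) : R := fine ('N[@counting nat R]_2%:E[EFin \o u]).

Lemma ell2_normZ (a : R) u : ell2_norm (a *: u) = `|a| * ell2_norm u.
Proof. by apply/EFin_inj; rewrite EFinM !finite_norm_fine -LnormZ. Qed.

Lemma ell2_norm0_eq0 u : ell2_norm u = 0 -> u = 0.
Proof.
move=> /fine_Lnormr_eq0[N [_ N0 uN]]; apply/val_inj/funext => n.
apply: contrapT => un0.
have Nn : N n by apply: uN => /= /(_ I).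
suff : (1 <= counting N :> \bar R)%E by rewrite N0 lee_fin ler10.
have <- : counting [set n] = 1%E :> \bar R.
  by rewrite /counting asboolT// fset_set1 finmap.cardfs1.
by apply: le_measure; rewrite ?inE// => _ ->.
Qed.

HB.instance Definition _ := @Lmodule_isNormed.Build R ell2 ell2_norm
  (@ler_LnormD _ _ _ _ _ _) ell2_normZ ell2_norm0_eq0.

Definition ell2_unit (n : nat) : nat -> R := fun k => (k == n)%:R.

Lemma ell2_unit_subproof n : ell2_unit n \in Lfun (@counting nat R) 2%:E.
Proof.
rewrite inE; apply/andP; split; rewrite inE//=.
rewrite /finite_norm Lnorm_counting// poweR_lty//.
rewrite (nneseries_split 0 n.+1); last by move=> k _; rewrite poweR_ge0.
rewrite eseries0 ?adde0.
  by apply: lte_sum_pinfty => k _; rewrite poweR_lty ?ltry.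
move=> k; rewrite add0n => nk _ /=.
by rewrite /ell2_unit gtn_eqF// normr0 powR0 ?pnatr_eq0.
Qed.

Definition e_ (n : nat) : ell2 := Lfun_Sub (lee1n 2) (ell2_unit_subproof n).
End ell2.

Section L1.
Context d (T : measurableType d) (R : realType) (nu : {measure set T -> \bar R}).
Local Notation ty := (LfunType nu (@lexx _ _ 1%E)).

Definition ae_zero : {pred ty} := mem [set f : ty | \forall x \ae nu, f x = 0].

Lemma ae_zero_submod_closed : submod_closed ae_zero.
Proof.
split; first by rewrite inE; exact: nearW.
move=> a f h; rewrite !inE => f0 h0.
rewrite /mkset; near=> x.
have fx0 : f x = 0 by near: x.
have hx0 : h x = 0 by near: x.
by rewrite -[LHS]/(a * f x + h x) fx0 hx0 mulr0 addr0.
Unshelve. all: by end_near. Qed.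

HB.instance Definition _ :=
  GRing.isSubmodClosed.Build R ty ae_zero ae_zero_submod_closed.

(* The measure nu is arbitrary: it need not be sigma-finite. *)
Definition L1 := Quotient.quot ae_zero.
HB.instance Definition _ := GRing.Zmodule.on L1.

Local Notation cls := (\pi_(Quotient.quot ae_zero)%qT : ty -> L1).

Lemma L1_eqP (f h : ty) : reflect (cls f = cls h) (f - h \in ae_zero).
Proof. by rewrite Quotient.idealrBE; exact: eqP. Qed.

Lemma L1_repr (f : ty) : repr (cls f) - f \in ae_zero.
Proof. by apply/L1_eqP; rewrite reprK. Qed.

Lemma clsD (f h : ty) : cls (f + h) = cls f + cls h.
Proof. exact: (Quotient.pi_add ae_zero). Qed.

Definition L1_scale (a : R) (q : L1) : L1 := cls (a *: repr q).

Lemma L1_scale_cls a f : L1_scale a (cls f) = cls (a *: f).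
Proof. by apply/L1_eqP; rewrite -scalerBr; apply: rpredZ; exact: L1_repr. Qed.

Lemma L1_scaleA a b q : L1_scale a (L1_scale b q) = L1_scale (a * b) q.
Proof. by rewrite -[q]reprK !L1_scale_cls scalerA reprK. Qed.

Lemma L1_scale1 : left_id 1 L1_scale.
Proof. by move=> q; rewrite -[q]reprK L1_scale_cls scale1r. Qed.

Lemma L1_scaleDr : right_distributive L1_scale +%R.
Proof.
by move=> a p q; rewrite -[p]reprK -[q]reprK -clsD !L1_scale_cls scalerDr clsD.
Qed.

Lemma L1_scaleDl q : {morph L1_scale^~ q : a b / a + b}.
Proof. by move=> a b; rewrite -[q]reprK !L1_scale_cls scalerDl clsD. Qed.

HB.instance Definition _ := GRing.Zmodule_isLmodule.Build R L1
  L1_scaleA L1_scale1 L1_scaleDr L1_scaleDl.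

Definition L1_norm (q : L1) : R := fine ('N[nu]_1[EFin \o (repr q : ty)]).

Lemma L1_norm_cls (f : ty) : L1_norm (cls f) = fine ('N[nu]_1[EFin \o f]).
Proof.
have := L1_repr f; rewrite inE/= => fr.
congr fine; rewrite !Lnorm1; apply: ae_eq_integral => //.
- by apply: (measurableT_comp (@abse_measurable R setT)); exact/measurable_EFinP.
- by apply: (measurableT_comp (@abse_measurable R setT)); exact/measurable_EFinP.
- apply: filterS fr => x + _ /=.
  by rewrite -[LHS]/(repr (cls f) x - f x) => /subr0_eq ->.
Qed.

Lemma ler_L1_normD p q : L1_norm (p + q) <= L1_norm p + L1_norm q.
Proof.
by rewrite -[p]reprK -[q]reprK -clsD !L1_norm_cls; exact: ler_LnormD.
Qed.

Lemma L1_normZ (a : R) q : L1_norm (a *: q) = `|a| * L1_norm q.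
Proof.
rewrite -[q]reprK -[_ *: _]/(L1_scale _ _) L1_scale_cls !L1_norm_cls.
by apply/EFin_inj; rewrite EFinM !finite_norm_fine -LnormZ.
Qed.

Lemma L1_norm0_eq0 q : L1_norm q = 0 -> q = 0.
Proof.
rewrite -[q]reprK L1_norm_cls => /fine_Lnormr_eq0 q0.
have -> : (0 : L1) = cls 0.
  by apply: (@addrI _ (cls 0)); rewrite addr0 -clsD addr0.
apply/L1_eqP; rewrite subr0 inE/=.
by apply: filterS q0 => x; apply.
Qed.

HB.instance Definition _ := @Lmodule_isNormed.Build R L1 L1_norm
  ler_L1_normD L1_normZ L1_norm0_eq0.
End L1.

Section operator_ideals.
Context (R : realType) (V W : normedModType R).

(* For V = ell2, these are the elements of the tensor product of ell2 and W. *)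
Definition finite_rank (u : V ->b W) :=
  exists s : seq W, forall x, exists c : nat -> R,
    u x = \sum_(i < size s) c i *: s`_i.

Definition weak_l1_norm (s : seq V) : R :=
  sup [set \sum_(x <- s) `|f x| | f in [set f : V ->b R^o | `|f| <= 1]].

(* The least admissible constant in the 1-summing inequality; +oo if u is not
   1-summing. *)
Definition pi1 (u : V ->b W) : \bar R :=
  ereal_inf [set C%:E | C in [set C : R | 0 <= C /\
    forall s : seq V, \sum_(x <- s) `|u x| <= C * weak_l1_norm s]].

Definition L1_factorization (u : V ->b W) (c : R) :=
  exists (d : measure_display) (Y : measurableType d)
    (nu : {measure set Y -> \bar R}) (A : V ->b L1 nu) (B : L1 nu ->b W),
    u = bop_comp B A /\ c = `|A| * `|B|.

Definition Gamma1 (u : V ->b W) := exists c, L1_factorization u c.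

(* As for pi1, the infimum over the empty set is +oo. *)
Definition gamma1 (u : V ->b W) : \bar R :=
  ereal_inf [set c%:E | c in [set c | L1_factorization u c]].

End operator_ideals.

Section gaussian.
Context d (Omega : measurableType d) (R : realType) (P : probability Omega R).

Definition mutually_independent (g : nat -> {RV P >-> R}) :=
  forall (s : seq nat) (A : nat -> set R), uniq s ->
    (forall n, measurable (A n)) ->
    P (\bigcap_(n in [set` s]) (g n @^-1` A n)) =
    (\prod_(n <- s) P (g n @^-1` A n))%E.

Definition standard_gaussian_sequence (g : nat -> {RV P >-> R}) :=
  mutually_independent g /\
  forall n (A : set R), measurable A ->
    distribution P (g n) A = normal_prob 0 1 A.

Context (g : nat -> {RV P >-> R}) (Z : normedModType R).

Definition vector_simple (f : Omega -> Z) :=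
  finite_set (range f) /\ forall z, measurable (f @^-1` [set z]).

Definition strongly_measurable (f : Omega -> Z) :=
  exists s : nat -> Omega -> Z, (forall k, vector_simple (s k)) /\
    forall t, s k t @[k --> \oo] --> f t.

Definition L2_norm (f : Omega -> Z) : \bar R :=
  'N[P]_2%:E[EFin \o (fun t => `|f t|)].

Definition gauss_partial_sum (T : ell2 R ->b Z) (N : nat) (t : Omega) : Z :=
  \sum_(n < N) g n t *: T (e_ R n).

Definition is_gauss_sum (T : ell2 R ->b Z) (f : Omega -> Z) :=
  strongly_measurable f /\
  L2_norm (fun t => gauss_partial_sum T N t - f t) @[N --> \oo] --> 0%E.

(* The sum of the series in L_2(P, Z), unique up to a null set. It exists when T
   has finite rank, so the default value is never used there. *)
Definition gauss_sum (T : ell2 R ->b Z) : Omega -> Z :=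
  xget (cst 0) [set f | is_gauss_sum T f].

Definition ell (T : ell2 R ->b Z) : \bar R := L2_norm (gauss_sum T).

(* The adjoint of T takes values in the dual of ell2, which is isometric to ell2;
   pi1 is invariant under this identification. *)
Definition GAP := exists K : R, forall T : ell2 R ->b Z, finite_rank T ->
  (ell T <= K%:E * pi1 (adjoint T))%E.

End gaussian.

(* Main.v *)
Require Import Defs.
From HB Require Import structures.
From mathcomp Require Import all_boot all_order all_algebra.
From mathcomp Require Import all_classical all_reals all_analysis.
From mathcomp Require Import measurable_realfun lra ring.
Set Implicit Arguments.
Unset Strict Implicit.
Unset Printing Implicit Defensive.
Import Order.TTheory GRing.Theory Num.Theory.
Import numFieldNormedType.Exports.
Local Open Scope classical_set_scope.
Local Open Scope ring_scope.

(* For the inequality, apply GAP to the first N terms of the Gaussian series of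
   [T], seen in [X]. A combination of independent Gaussians with l2 norm of
   coefficients r has first absolute moment at least c r, so that a weak l1
   bound on functionals of [E] controls the l2 norms of their images under the
   adjoint of [T] by the mean norm of the Gaussian sum; the latter does not see
   whether the sum is taken in [E] or in [X].

   For the extension, trace duality bounds the trace form of [S] on the tensors
   of l2 and [E] by gamma_1(S) times the 1-summing norm of the adjoint, hence,
   by the inequality, by the 1-summing norm computed in [X], hence by the
   projective norm of X (x) B, where B is the space of bounded functions on the
   unit ball of l2. By the Hahn-Banach theorem the form extends to a family of
   finitely additive measures m_x on the ball, linear in x, such that S x is the
   barycenter of m_x for x in [E]. Because the squares of the norms of the
   increments of the coordinate projections add up, the barycenter map is
   Bochner integrable in a discretized sense. Rounding the points of the ball to
   a countable dictionary, and iterating on the remainders, which are halved,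
   writes the barycenter of m_x as a series of dictionary elements with
   coefficients in l1 that depend linearly on x. This factors the extension
   through L1 of the counting measure. *)

(** * The Hahn-Banach theorem *)

(** The natural factorization of the extension passes through the dual of B: [x] goes to [m_x], and
    a measure to its barycenter. This dual is only an abstract L-space; replacing it by l1 makes the
    measure space explicit, at the price of a factor 4. The obstacle is that [m_x] is only finitely
    additive and that the ball of l2 is not norm compact, so that rounding could push mass to
    dictionary elements of ever larger index. Points are therefore rounded after truncation to [k]
    coordinates. A truncation at [k] that stays within 1/4 of the truncation at [p] receives an
    index below a bound depending on [p] alone, and the rest of the ball has small weight, uniformly
    in [k >= p]. Limits in [k] are taken along an ultrafilter, which keeps the dependence on [x]
    linear. On the Gaussian side any positive lower bound for the first absolute moment will do. It
    is drawn from exponential moments, which factor under independence, rather than from the law of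
    a sum of Gaussians. *)

Section hahn_banach.
Context (R : realType) (V : lmodType R) (p : V -> R).
Hypothesis p_add : forall u v, p (u + v) <= p u + p v.
Hypothesis p_scale : forall a u, 0 < a -> p (a *: u) = a * p u.

(** Partial functionals are encoded by their graphs, so that chains have unions. Single-valuedness
    comes from domination: the difference of two points over the same vector lies over 0, where [p]
    vanishes. *)
Definition dominated_graph (G : set (V * R)) :=
  (forall a y z, G y -> G z -> G (a *: y.1 + z.1, a * y.2 + z.2)) /\
  (forall z, G z -> z.2 <= p z.1).

(** The value at [v0] must lie above all [y.2 - p (y.1 - v0)] and below all [p (w.1 + v0) - w.2];
    subadditivity puts the first numbers below the second. The two bounds serve the negative and the
    positive multiples of [v0]. *)
Lemma dominated_graph_extend (G : set (V * R)) (v0 : V) :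
  dominated_graph G -> G (0, 0) ->
  exists c, dominated_graph
    [set z | exists y t, G y /\ z = (y.1 + t *: v0, y.2 + t * c)].
Proof.
move=> [Glin Gp] G0.
have GZ a y : G y -> G (a *: y.1, a * y.2).
  by move=> Gy; have := Glin a _ _ Gy G0; rewrite /= !addr0.
pose B := [set y.2 - p (y.1 - v0) | y in G].
have Bub w : G w -> ubound B (p (w.1 + v0) - w.2).
  move=> Gw _ [y Gy <-].
  have := Gp _ (Glin 1 _ _ Gy Gw); rewrite /= scale1r mul1r => h.
  have := p_add (y.1 - v0) (w.1 + v0).
  by rewrite addrACA addNr addr0 => h'; lra.
have B0 : has_sup B.
  by split; [exists (0 - p (0 - v0)), (0, 0) | exists (p (0 + v0) - 0); exact: Bub _ G0].
exists (sup B); split.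
  move=> a _ _ [y [t [Gy ->]]] [z [s [Gz ->]]] /=.
  exists (a *: y.1 + z.1, a * y.2 + z.2), (a * t + s); split; first exact: Glin.
  congr (_, _) => /=; last by ring.
  by rewrite scalerDr scalerDl !scalerA addrACA.
move=> _ [y [t [Gy ->]]] /=.
have [t0|t0|->] := ltgtP t 0; last first.
- by rewrite mul0r scale0r !addr0 Gp.
- have h : sup B <= p ((t^-1 *: y.1) + v0) - t^-1 * y.2.
    by apply: ge_sup; [case: B0 | exact: Bub _ (GZ _ _ Gy)].
  have tp : t * t^-1 = 1 by rewrite divff// gt_eqF.
  have : t * sup B <= t * (p (t^-1 *: y.1 + v0) - t^-1 * y.2).
    by rewrite ler_pM2l.
  by rewrite mulrBr mulrA tp mul1r -p_scale// scalerDr scalerA tp scale1r => k; lra.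
- pose s := - t; have s0 : 0 < s by rewrite oppr_gt0.
  have ss : s * s^-1 = 1 by rewrite divff// gt_eqF.
  have h : s^-1 * y.2 - p (s^-1 *: y.1 - v0) <= sup B.
    apply: ub_le_sup; first by case: B0.
    by exists (s^-1 *: y.1, s^-1 * y.2) => //; exact: GZ.
  have : s * (s^-1 * y.2 - p (s^-1 *: y.1 - v0)) <= s * sup B by rewrite ler_pM2l.
  rewrite mulrBr mulrA ss mul1r -p_scale// scalerBr scalerA ss scale1r.
  by rewrite /s scaleNr opprK => k; lra.
Qed.

Theorem hahn_banach (W : set V) (phi : V -> R) :
  W 0 -> (forall a u v, W u -> W v -> W (a *: u + v)) ->
  (forall a u v, W u -> W v -> phi (a *: u + v) = a * phi u + phi v) ->
  (forall u, W u -> phi u <= p u) ->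
  exists F : V -> R, [/\ forall a u v, F (a *: u + v) = a * F u + F v,
    forall u, W u -> F u = phi u & forall u, F u <= p u].
Proof.
move=> W0 Wlin philin phip.
pose G0 := [set (u, phi u) | u in W].
have phi0 : phi 0 = 0 by have := philin 1 0 0 W0 W0; rewrite scaler0 addr0; lra.
have dG0 : dominated_graph G0.
  split; last by move=> _ [u Wu <-]; exact: phip.
  move=> a _ _ [u Wu <-] [v Wv <-] /=; exists (a *: u + v); first exact: Wlin.
  by rewrite philin.
(* Joining [G0] inside the predicate makes the union of the empty chain admissible and forces the
   maximal graph to extend [phi]. *)
have [|A [dA Amax]] := @Zorn_bigcup _ [set G | dominated_graph (G `|` G0)].
  move=> C Cd Ctot; split; last first.
    move=> z [[X CX Xz]|]; last exact: dG0.2.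
    by apply: (Cd _ CX).2; left.
  have key y z : (\bigcup_(X in C) X `|` G0) y -> (\bigcup_(X in C) X `|` G0) z ->
    (G0 y /\ G0 z) \/ exists2 X, C X & (X `|` G0) y /\ (X `|` G0) z.
    move=> [[X CX Xy]|Gy] [[Y CY Yz]|Gz].
    - right; have [XY|YX] := Ctot _ _ CX CY.
        by exists Y => //; split; left => //; exact: XY.
      by exists X => //; split; left => //; exact: YX.
    - by right; exists X => //; split; [left|right].
    - by right; exists Y => //; split; [right|left].
    - by left.
  move=> a y z /key/[apply] -[[Gy Gz]|[X CX [Xy Xz]]].
    by right; exact: dG0.1.
  have [?|?] := (Cd _ CX).1 a _ _ Xy Xz; last by right.
  by left; exists X.
pose G := A `|` G0.
have Gz : G (0, 0) by right; exists 0; rewrite ?phi0.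
have full v0 : exists r, G (v0, r).
  apply: contrapT => /forallNP nG.
  have [c dc] := dominated_graph_extend v0 dA Gz.
  set G' := (X in dominated_graph X) in dc.
  have GG' : G `<=` G'.
    move=> [u r] Gu; exists (u, r), 0; split => //=.
    by rewrite scale0r mul0r !addr0.
  have Gv0 : G' (v0, c).
    by exists (0, 0), 1; split => //=; rewrite scale1r mul1r !add0r.
  apply: (Amax G').
    split; first by move=> z Az; apply: GG'; left.
    by move=> /(_ _ Gv0) Av; apply: (nG c); left.
  have -> : [set G1 | dominated_graph (G1 `|` G0)] G' = dominated_graph G'.
    rewrite /=; congr dominated_graph; apply/seteqP; split; last by left.
    by move=> z [//|Gz0]; apply: GG'; right.
  exact: dc.
have p0 : p 0 = 0.
  by have := p_scale 0 (ltr0n R 2); rewrite scaler0; lra.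
have Gfun u r s : G (u, r) -> G (u, s) -> r = s.
  suff le r' s' : G (u, r') -> G (u, s') -> r' <= s'.
    by move=> h k; apply/le_anti; rewrite !le.
  move=> h k; have := dA.2 _ (dA.1 (-1) _ _ k h).
  by rewrite /= scaleN1r addNr p0; lra.
pose F v := projT1 (cid (full v)).
have GF v : G (v, F v) by exact: projT2 (cid (full v)).
exists F; split.
- move=> a u v; apply: (Gfun (a *: u + v)); first exact: GF.
  exact: dA.1 _ _ _ (GF u) (GF v).
- by move=> u Wu; apply: (Gfun u); [exact: GF | right; exists u].
- by move=> u; exact: dA.2 _ (GF u).
Qed.
End hahn_banach.

(** * Coordinates in l2 *)

Section ell2_coordinates.
Context (R : realType).
Local Notation ell2 := (ell2 R).
Implicit Types (h a : ell2) (n k : nat).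

Lemma ell2D h a k : (h + a) k = h k + a k. Proof. by []. Qed.

Lemma ell2Z (c : R) h k : (c *: h) k = c * h k. Proof. by []. Qed.

Lemma ell2N h k : (- h) k = - h k. Proof. by []. Qed.

Lemma ell2_sum (I : Type) (s : seq I) (F : I -> ell2) k :
  (\sum_(i <- s) F i) k = \sum_(i <- s) F i k.
Proof.
by elim: s => [|i s IH]; rewrite ?big_nil// !big_cons ell2D IH.
Qed.

Lemma e_E n k : e_ R n k = (k == n)%:R. Proof. by []. Qed.

Lemma ell2P h a : (forall k, h k = a k) -> h = a.
Proof. by move=> ha; apply/val_inj/funext. Qed.

Lemma sqr_ell2_norm h :
  ((`|h| ^+ 2)%:E = \sum_(0 <= k <oo) ((h k) ^+ 2)%:E)%E.
Proof.
rewrite -[`|h|]/(ell2_norm h).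
have nh : (0 <= ell2_norm h)%R by rewrite fine_ge0// Lnorm_ge0.
rewrite -powR_mulrn// -poweR_EFin finite_norm_fine Lnorm_counting//.
rewrite -poweRrM mulVf ?pnatr_eq0// poweRe1; last first.
  by apply: nneseries_ge0 => k _ _; exact: poweR_ge0.
apply: eq_eseriesr => k _ /=.
by rewrite powR_mulrn // -normrX ger0_norm ?sqr_ge0.
Qed.

Lemma ell2_sum_sqr_le h n : \sum_(k < n) (h k) ^+ 2 <= `|h| ^+ 2.
Proof.
rewrite -lee_fin sqr_ell2_norm -sumEFin.
rewrite -(big_mkord xpredT (fun k => ((h k) ^+ 2)%:E)).
by apply: nneseries_lim_ge => k _ _; rewrite lee_fin sqr_ge0.
Qed.

Lemma ell2_norm_le h (M : R) : 0 <= M ->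
  (forall n, \sum_(k < n) (h k) ^+ 2 <= M ^+ 2) -> `|h| <= M.
Proof.
move=> M0 hM; rewrite -(@ler_pXn2r _ 2)// ?nnegrE//.
rewrite -lee_fin sqr_ell2_norm; apply: lime_le.
  by apply: is_cvg_nneseries => k _ _; rewrite lee_fin sqr_ge0.
by apply: nearW => n; rewrite sumEFin lee_fin big_mkord.
Qed.

Lemma ell2_coord_le h k : `|h k| <= `|h|.
Proof.
rewrite -(@ler_pXn2r _ 2)// ?nnegrE// -normrX ger0_norm ?sqr_ge0//.
apply: le_trans (ell2_sum_sqr_le h k.+1); rewrite big_ord_recr /=.
by rewrite lerDr sumr_ge0// => i _; exact: sqr_ge0.
Qed.

Lemma ell2_build (u : nat -> R) (M : R) :
  (forall n, \sum_(k < n) (u k) ^+ 2 <= M ^+ 2) ->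
  exists h : ell2, forall k, h k = u k.
Proof.
move=> uM; suff uL : u \in Lfun (@counting nat R) 2%:E.
  by exists (Lfun_Sub (lee1n 2) uL).
rewrite inE; apply/andP; split; rewrite inE//=.
rewrite /finite_norm Lnorm_counting// poweR_lty//.
apply: (@le_lt_trans _ _ (M ^+ 2)%:E); last exact: ltry.
apply: lime_le.
  by apply: is_cvg_nneseries => k _ _; exact: poweR_ge0.
apply: nearW => n; rewrite big_mkord.
apply: le_trans (_ : (\sum_(k < n) (u k) ^+ 2)%:E <= _)%E; last by rewrite lee_fin.
rewrite -sumEFin; apply: lee_sum => k _ /=.
by rewrite powR_mulrn // -normrX ger0_norm ?sqr_ge0.
Qed.

Definition trunc n h : ell2 := \sum_(k < n) h k *: e_ R k.

Lemma truncE n h k : trunc n h k = if (k < n)%N then h k else 0.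
Proof.
rewrite /trunc ell2_sum; under eq_bigr do rewrite ell2Z e_E.
case: ifPn => kn.
  rewrite (bigD1 (Ordinal kn))//= eqxx mulr1 big1 ?addr0// => i ik.
  rewrite (_ : (_ == _) = false) ?mulr0//; apply: contra_neqF ik => /eqP ki.
  by apply/val_inj; rewrite /= ki.
rewrite big1// => i _; rewrite (_ : (_ == _) = false) ?mulr0//.
by apply: contraNF kn => /eqP ->.
Qed.

Lemma trunc_linear n : linear (trunc n).
Proof.
move=> a x y; apply: ell2P => k; rewrite ell2D ell2Z !truncE.
by case: ifP => //; rewrite mulr0 addr0.
Qed.

Lemma sqr_norm_trunc n h : `|trunc n h| ^+ 2 = \sum_(k < n) (h k) ^+ 2.
Proof.
apply/eqP; rewrite eq_le; apply/andP; split; last first.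
  apply: le_trans (ell2_sum_sqr_le (trunc n h) n).
  by rewrite le_eqVlt; apply/orP; left; apply/eqP/eq_bigr => k _; rewrite truncE ltn_ord.
rewrite -lee_fin sqr_ell2_norm; apply: lime_le.
  by apply: is_cvg_nneseries => k _ _; rewrite lee_fin sqr_ge0.
apply: nearW => m; rewrite sumEFin lee_fin big_mkord.
have [nm|mn] := leqP n m.
  rewrite -(big_mkord xpredT (fun k => trunc n h k ^+ 2)) (big_cat_nat (leq0n n) nm)//=.
  rewrite [X in _ + X]big_nat_cond [X in _ + X]big1 ?addr0; last first.
    by move=> i /andP[/andP[ni _] _]; rewrite truncE ltnNge ni expr0n.
  by rewrite big_mkord ler_sum// => k _; rewrite truncE ltn_ord.
rewrite -(big_mkord xpredT (fun k => h k ^+ 2)) (big_cat_nat (leq0n m) (ltnW mn))//=.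
rewrite big_mkord -[leLHS]addr0 lerD//.
  by rewrite ler_sum// => k _; rewrite truncE (ltn_trans (ltn_ord k)).
by rewrite sumr_ge0// => i _; exact: sqr_ge0.
Qed.

Lemma norm_trunc_le n h : `|trunc n h| <= `|h|.
Proof.
by rewrite -(@ler_pXn2r _ 2)// ?nnegrE// sqr_norm_trunc ell2_sum_sqr_le.
Qed.

(** Pythagoras for two disjoint blocks of coordinates; it is the identity behind the tail estimate
    for finitely additive measures. *)
Lemma sqr_norm_trunc_sub n m h : (n <= m)%N ->
  `|trunc m h - trunc n h| ^+ 2 + `|trunc n h| ^+ 2 = `|trunc m h| ^+ 2.
Proof.
move=> nm; set d := trunc m h - trunc n h.
have dE k : d k = if (k < n)%N then 0 else trunc m h k.
  rewrite /d ell2D ell2N (truncE n); case: ifPn => kn; last by rewrite subr0.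
  by rewrite truncE (leq_trans kn nm) subrr.
have -> : d = trunc m d.
  apply: ell2P => k; rewrite truncE dE !truncE.
  by case: ifP => //; case: ifP.
rewrite !sqr_norm_trunc -!(big_mkord xpredT (fun k => _ k ^+ 2)).
rewrite (big_cat_nat (leq0n n) nm)//= [RHS](big_cat_nat (leq0n n) nm)//=.
rewrite [X in X + _ + _]big_nat_cond [X in X + _ + _]big1; last first.
  by move=> i /andP[/andP[_ ni] _]; rewrite -[(_ - _) i]/(d i) dE ni expr0n.
rewrite add0r addrC; congr (_ + _); apply: eq_big_nat => i /andP[ni im].
by rewrite -[(_ - _) i]/(d i) dE ltnNge ni/= truncE im.
Qed.

Lemma norm_trunc_sub_le n m h : (n <= m)%N -> `|trunc m h - trunc n h| <= `|h|.
Proof.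
move=> nm; rewrite (@le_trans _ _ `|trunc m h|)// ?norm_trunc_le//.
rewrite -(@ler_pXn2r _ 2)// ?nnegrE// -(sqr_norm_trunc_sub h nm).
by rewrite lerDl sqr_ge0.
Qed.

Lemma trunc_cvg h : trunc n h @[n --> \oo] --> h.
Proof.
have Hcvg : (\sum_(k < n) h k ^+ 2) @[n --> \oo] --> `|h| ^+ 2.
  have H : (fun n => (\sum_(0 <= k < n) (h k ^+ 2)%:E)%E) @ \oo --> (`|h| ^+ 2)%:E.
    rewrite sqr_ell2_norm; apply: is_cvg_nneseries => k _ _.
    by rewrite lee_fin sqr_ge0.
  have /fine_cvg := H; apply: cvg_trans; apply: near_eq_cvg.
  by apply: nearW => n /=; rewrite sumEFin big_mkord.
apply/cvgrPdist_le => e e0.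
have e20 : 0 < e ^+ 2 by rewrite exprn_gt0.
move/cvgrPdist_le : Hcvg => /(_ _ e20); apply: filterS => n.
rewrite -sqr_norm_trunc => hn.
rewrite -(@ler_pXn2r _ 2)// ?nnegrE//; last exact: ltW.
apply: le_trans hn.
(* Pythagoras for the tail of [h], obtained by testing every finite block of coordinates with
   [sqr_norm_trunc_sub]. *)
suff le1 : `|h - trunc n h| ^+ 2 <= `|h| ^+ 2 - `|trunc n h| ^+ 2.
  exact: le_trans le1 (ler_norm _).
have t0 : 0 <= `|h| ^+ 2 - `|trunc n h| ^+ 2.
  by rewrite subr_ge0 ler_pXn2r ?nnegrE// norm_trunc_le.
rewrite -[leRHS]sqr_sqrtr// ler_pXn2r ?nnegrE ?sqrtr_ge0//.
apply: ell2_norm_le; rewrite ?sqrtr_ge0// => m; rewrite sqr_sqrtr//.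
rewrite lerBrDr.
pose q := maxn m n.
apply: le_trans (ell2_sum_sqr_le h q).
rewrite -[leRHS]sqr_norm_trunc /q -(sqr_norm_trunc_sub h (leq_maxr m n)) lerD2r.
rewrite -/q -[leLHS]sqr_norm_trunc (ler_pXn2r) ?nnegrE//.
apply: le_trans (norm_trunc_le m (trunc q h - trunc n h)).
rewrite le_eqVlt; apply/orP; left; apply/eqP; congr `|_|.
apply: ell2P => k; rewrite !truncE !ell2D !ell2N !truncE.
by case: ifP => // km; rewrite (leq_trans km (leq_maxl _ _)).
Qed.

End ell2_coordinates.

(** * Finite nets of the truncated balls and a countable dictionary *)

Section ell2_net.
Context (R : realType).
Local Notation ell2 := (ell2 R).

Lemma norm_e_le n : `|e_ R n| <= 1.
Proof.
apply: ell2_norm_le => // m; rewrite expr1n.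
have [nm|mn] := ltnP n m; last first.
  rewrite big1// => i _; rewrite e_E (_ : (_ == _) = false) ?expr0n//.
  by rewrite ltn_eqF// (leq_trans (ltn_ord i) mn).
rewrite (bigD1 (Ordinal nm))// big1 => [|i /eqP ni].
  by rewrite e_E eqxx expr1n /= addr0.
rewrite e_E (_ : (_ == _) = false) ?expr0n//.
by apply/negbTE/eqP => ni'; apply: ni; apply/val_inj.
Qed.

Lemma real_net (e : R) : 0 < e -> exists T : seq R,
  forall x, `|x| <= 1 -> exists2 t, t \in T & `|x - t| <= e.
Proof.
move=> e0; exists [seq i%:R * e - 1 | i <- iota 0 (Num.truncn (2 / e)).+1].
move=> x; rewrite ler_norml => /andP[x1 x2].
have y0 : 0 <= (x + 1) / e by rewrite divr_ge0 ?(ltW e0)//; lra.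
have /andP[h1 h2] := truncn_itv y0; set i := Num.truncn _ in h1 h2.
exists (i%:R * e - 1).
  apply/mapP; exists i => //; rewrite mem_iota/= add0n ltnS le_truncn//.
  by rewrite ler_pM2r ?invr_gt0//; lra.
rewrite ler_norml; move: h1 h2; rewrite ler_pdivlMr// ltr_pdivrMr// -natr1 mulrDl.
by move=> h1 h2; apply/andP; split; lra.
Qed.

Lemma trunc_net n (e : R) : 0 < e -> exists L : seq ell2,
  forall h, `|h| <= 1 -> exists2 s, s \in L & `|trunc n h - s| <= e.
Proof.
elim: n e => [|n IH] e e0.
  exists [:: 0] => h _; exists 0; rewrite ?mem_head//.
  by rewrite /trunc big_ord0 subrr normr0 ltW.
have e20 : 0 < e / 2 by rewrite divr_gt0.
have [L HL] := IH _ e20; have [T HT] := real_net e20.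
exists [seq s + t *: e_ R n | s <- L, t <- T] => h h1.
have [s sL hs] := HL _ h1.
have [t tT ht] := HT _ (le_trans (ell2_coord_le h n) h1).
exists (s + t *: e_ R n); first by apply/allpairsP; exists (s, t).
rewrite /trunc big_ord_recr/= -/(trunc n h) opprD addrACA -scalerBl.
apply: (le_trans (ler_normD _ _)); rewrite normrZ [leRHS]splitr lerD//.
by apply: le_trans ht; rewrite ler_piMr// norm_e_le.
Qed.

(** The nets of all dimensions are enumerated together through [pickle]. Net points of norm above 2
    are replaced by 0, which loses nothing: a point within [e <= 1] of the unit ball has norm at
    most 2. The bound [N] on the index, uniform over the ball for each [n], is what later prevents
    mass from escaping. *)
Lemma ell2_dictionary (e : R) : 0 < e -> e <= 1 -> exists s : nat -> ell2,
  (forall i, `|s i| <= 2) /\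
  forall n, exists N, forall h, `|h| <= 1 ->
    exists2 i, (i < N)%N & `|trunc n h - s i| <= e.
Proof.
move=> e0 e1.
have /choice[L HL] := fun n => trunc_net n e0.
pose s i := if unpickle i is Some q then
  let v := nth 0 (L q.1) q.2 in if `|v| <= 2 then v else 0 else 0.
exists s; split => [i|n].
  by rewrite /s; case: unpickle => [q|]; rewrite ?normr0//; case: ifP; rewrite ?normr0.
exists (\max_(p < size (L n)) pickle (n, val p)).+1 => h h1.
have [v vL hv] := HL n _ h1.
have vs : (index v (L n) < size (L n))%N by rewrite index_mem.
exists (pickle (n, index v (L n))).
  by rewrite ltnS; exact: (leq_bigmax (Ordinal vs)).
rewrite /s pickleK/= nth_index// ifT//.
rewrite -[v](subrK (trunc n h)) (le_trans (ler_normD _ _))// distrC.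
by rewrite -[leRHS]/(1 + 1) lerD// ?(le_trans hv)// (le_trans (norm_trunc_le _ _)).
Qed.

End ell2_net.

(** * Functionals on bounded functions on the ball of l2 *)

Section ball_functional.
Context (R : realType).
Local Notation ell2 := (ell2 R).

Definition ball_bounded (f : ell2 -> R) (M : R) := forall h, `|h| <= 1 -> `|f h| <= M.

Lemma ball_bounded_ge0 f M : ball_bounded f M -> 0 <= M.
Proof. by move=> /(_ 0); rewrite normr0 ler01 => /(_ isT); apply: le_trans. Qed.

Lemma ball_boundedD f g M N : ball_bounded f M -> ball_bounded g N ->
  ball_bounded (fun h => f h + g h) (M + N).
Proof. by move=> fM gN h h1; rewrite (le_trans (ler_normD _ _))// lerD ?fM ?gN. Qed.

Lemma ball_boundedZ a f M : ball_bounded f M -> ball_bounded (fun h => a * f h) (`|a| * M).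
Proof. by move=> fM h h1; rewrite normrM ler_wpM2l// fM. Qed.

(* A bounded finitely additive measure on the unit ball; the values of [mu] at
   functions that are unbounded on the ball are irrelevant. *)
Record bounded_functional (K : R) (mu : (ell2 -> R) -> R) : Prop := BoundedFunctional {
  bf_lin : forall a f g M N, ball_bounded f M -> ball_bounded g N ->
    mu (fun h => a * f h + g h) = a * mu f + mu g ;
  bf_le : forall f M, ball_bounded f M -> `|mu f| <= K * M }.

Section one_functional.
Context (K : R) (mu : (ell2 -> R) -> R) (bmu : bounded_functional K mu).

Lemma bf0 : mu (fun=> 0) = 0.
Proof.
apply/eqP; rewrite -normr_le0; apply: le_trans (bf_le bmu (M := 0) _) _.
  by move=> h _; rewrite normr0.
by rewrite mulr0.
Qed.

Lemma bfD f g M N : ball_bounded f M -> ball_bounded g N ->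
  mu (fun h => f h + g h) = mu f + mu g.
Proof.
move=> fM gN; have := bf_lin bmu 1 fM gN; rewrite mul1r => <-.
by congr mu; apply/funext => h; rewrite mul1r.
Qed.

Lemma bfZ a f M : ball_bounded f M -> mu (fun h => a * f h) = a * mu f.
Proof.
move=> fM; have b0 : ball_bounded (fun=> 0) 0 by move=> h _; rewrite normr0.
have := bf_lin bmu a fM b0; rewrite bf0 addr0 => <-.
by congr mu; apply/funext => h; rewrite addr0.
Qed.

Lemma bf_sum (I : Type) (s : seq I) (F : I -> ell2 -> R) (M : I -> R) :
  (forall i, ball_bounded (F i) (M i)) ->
  mu (fun h => \sum_(i <- s) F i h) = \sum_(i <- s) mu (F i).
Proof.
move=> FM; elim: s => [|i s IH].
  by rewrite big_nil -[RHS]bf0; congr mu; apply/funext => h; rewrite big_nil.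
rewrite big_cons -IH -(@bfD _ _ (M i) (\sum_(i <- s) M i))//.
  by congr mu; apply/funext => h; rewrite big_cons.
move=> h h1; apply: (le_trans (ler_norm_sum _ _ _)).
by apply: ler_sum => j _; exact: FM.
Qed.

(** For [F >= 0] this is the value at [F] of the total variation of [mu]. *)
Definition variation (F : ell2 -> R) :=
  sup [set mu g | g in [set g | forall h, `|h| <= 1 -> `|g h| <= F h]].

Lemma variation_has_sup F M : ball_bounded F M -> (forall h, 0 <= F h) ->
  has_sup [set mu g | g in [set g | forall h, `|h| <= 1 -> `|g h| <= F h]].
Proof.
move=> FM F0; split; first by exists (mu (fun=> 0)), (fun=> 0) => //= h _; rewrite normr0.
exists (K * M) => _ [g /= gF <-]; apply: (le_trans (ler_norm _)).
by apply: bf_le => // h h1; apply: (le_trans (gF _ h1)); rewrite (le_trans (ler_norm _))// FM.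
Qed.

Lemma variation_le F M : ball_bounded F M -> (forall h, 0 <= F h) ->
  variation F <= K * M.
Proof.
move=> FM F0; apply: ge_sup; first by case: (variation_has_sup FM F0).
move=> _ [g /= gF <-]; apply: (le_trans (ler_norm _)).
by apply: bf_le => // h h1; apply: (le_trans (gF _ h1)); rewrite (le_trans (ler_norm _))// FM.
Qed.

Lemma le_variation F M g : ball_bounded F M -> (forall h, 0 <= F h) ->
  (forall h, `|h| <= 1 -> `|g h| <= F h) -> `|mu g| <= variation F.
Proof.
move=> FM F0 gF.
have gM : ball_bounded g M.
  by move=> h h1; rewrite (le_trans (gF _ h1))// (le_trans (ler_norm _))// FM.
rewrite ler_norml; apply/andP; split.
  rewrite lerNl -mulN1r -(bfZ _ gM); apply: ub_le_sup; first by case: (variation_has_sup FM F0).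
  by exists (fun h => -1 * g h) => //= h h1; rewrite mulN1r normrN gF.
by apply: ub_le_sup; [case: (variation_has_sup FM F0) | exists g].
Qed.

Lemma variation_superadd F G M N : ball_bounded F M -> ball_bounded G N ->
  (forall h, 0 <= F h) -> (forall h, 0 <= G h) ->
  variation F + variation G <= variation (fun h => F h + G h).
Proof.
move=> FM GN F0 G0.
have sF := variation_has_sup FM F0; have sG := variation_has_sup GN G0.
rewrite -lerBrDr; apply: ge_sup; first by case: sF.
move=> _ [f /= fF <-]; rewrite lerBrDr -lerBrDl; apply: ge_sup; first by case: sG.
move=> _ [g /= gG <-]; rewrite lerBrDl -(@bfD _ _ M N).
- apply: ub_le_sup.
    have := @variation_has_sup (fun h => F h + G h) (M + N).
    by case; [exact: ball_boundedD | move=> h; rewrite addr_ge0|].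
  exists (fun h => f h + g h) => //= h h1.
  by rewrite (le_trans (ler_normD _ _))// lerD ?fF ?gG.
- by move=> h h1; rewrite (le_trans (fF _ h1))// (le_trans (ler_norm _))// FM.
- by move=> h h1; rewrite (le_trans (gG _ h1))// (le_trans (ler_norm _))// GN.
Qed.

(* The squares of the norms of the increments of [trunc] add up, and the
   variation is superadditive: this replaces countable additivity. *)
Lemma variation_tail (e : R) : 0 < e -> exists n, forall k, (n <= k)%N ->
  forall g, (forall h, `|h| <= 1 -> `|g h| <= `|trunc k h - trunc n h| ^+ 2) ->
  `|mu g| <= e.
Proof.
move=> e0.
pose Q k := variation (fun h => `|trunc k h| ^+ 2).
have bd k : ball_bounded (fun h => `|trunc k h| ^+ 2) 1.
  move=> h h1; rewrite ger0_norm ?sqr_ge0// exprn_ile1//.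
  exact: le_trans (norm_trunc_le _ _) _.
have Qsup : has_sup (range Q).
  split; first by exists (Q 0%N), 0%N.
  by exists K => _ [k _ <-]; rewrite -[K]mulr1; apply: variation_le (bd k) _ => h; exact: sqr_ge0.
(* [Q] is bounded; at an [n] where it is within [e] of its supremum, superadditivity leaves at most
   [Q k - Q n < e] for the increment from [n] to [k]. *)
have [_ [n _ <-] Qn] := sup_adherent e0 Qsup.
exists n => k nk g gd.
have bdd : ball_bounded (fun h => `|trunc k h - trunc n h| ^+ 2) 1.
  move=> h h1; rewrite ger0_norm ?sqr_ge0// exprn_ile1//.
  exact: le_trans (norm_trunc_sub_le _ nk) _.
have := le_variation bdd (fun h => sqr_ge0 _) gd.
have := variation_superadd bdd (bd n) (fun h => sqr_ge0 _) (fun h => sqr_ge0 _).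
rewrite (_ : (fun h => _ + _) = (fun h => `|trunc k h| ^+ 2)); last first.
  by apply/funext => h; exact: sqr_norm_trunc_sub.
have : Q k <= sup (range Q) by apply: ub_le_sup; [case: Qsup | exists k].
rewrite -/(Q k) -/(Q n); move: (variation _) (Q k) (Q n) (sup _) Qn => v a b c; lra.
Qed.

End one_functional.
End ball_functional.

(** * Limits along an ultrafilter *)

Lemma ultra_image_filter (T V : Type) (U : set_system T) (u : T -> V) :
  UltraFilter U -> UltraFilter (u @ U).
Proof.
move=> UU; split; first exact: fmap_proper_filter.
move=> G GG UG; apply/seteqP; split => // A GA.
have [//|UA] := in_ultra_setVsetC (u @^-1` A) UU.
have : G (A `&` ~` A) by apply: filterI => //; exact: UG.
by rewrite setICr => /filter_not_empty.
Qed.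

Section ultralimit.
Context (R : realType) (U : set_system nat) (UU : UltraFilter U).
Hypothesis subU : \oo `<=` U.

(** Every bounded sequence has such a limit, and it is linear in the sequence. A convergent
    subsequence would depend on the vector [x] and destroy linearity in [x]. *)
Definition ulim (u : nat -> R) : R := lim (u @ U).

Lemma cvg_ulim (u : nat -> R) (M : R) : (forall k, `|u k| <= M) -> u @ U --> ulim u.
Proof.
move=> uM.
have /= := @segment_compact R (- M) M; rewrite compact_ultra => /(_ (u @ U)).
have FU : UltraFilter (u @ U) by exact: ultra_image_filter.
have uB : (u @ U) [set` `[- M, M]].
  by apply: nearW => k /=; rewrite in_itv/= -ler_norml.
by move=> /(_ FU uB) [l [_ ul]]; apply/cvg_ex; exists l.
Qed.

Lemma ulim_le (u : nat -> R) (M : R) : (forall k, `|u k| <= M) -> `|ulim u| <= M.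
Proof.
move=> uM; have := cvg_ulim uM => /cvg_norm uc.
rewrite -(cvg_lim _ uc)//; apply: limr_le; first exact: cvgP uc.
exact: nearW.
Qed.

Lemma ulim_lin a (u v : nat -> R) (M N : R) :
  (forall k, `|u k| <= M) -> (forall k, `|v k| <= N) ->
  ulim (fun k => a * u k + v k) = a * ulim u + ulim v.
Proof.
move=> uM vN; apply: cvg_lim => //.
by apply: cvgD; [apply: cvgMl_tmp; exact: cvg_ulim uM | exact: cvg_ulim vN].
Qed.

Lemma ulim_sum (I : Type) (s : seq I) (u : I -> nat -> R) (M : I -> R) :
  (forall i k, `|u i k| <= M i) ->
  ulim (fun k => \sum_(i <- s) u i k) = \sum_(i <- s) ulim (u i).
Proof.
move=> uM; apply: cvg_lim => //; elim: s => [|i s IH].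
  by under eq_fun do rewrite big_nil; rewrite big_nil; exact: cvg_cst.
under eq_fun do rewrite big_cons; rewrite big_cons.
by apply: cvgD => //; exact: cvg_ulim (uM i).
Qed.

Lemma ulim_eventually_le (u : nat -> R) (M : R) e n :
  (forall k, `|u k| <= M) -> (forall k, (n <= k)%N -> `|u k| <= e) -> `|ulim u| <= e.
Proof.
move=> uM ue; have := cvg_ulim uM => /cvg_norm uc.
rewrite -(cvg_lim _ uc)//; apply: limr_le; first exact: cvgP uc.
by apply: subU; exists n => // k /= nk; exact: ue.
Qed.

Lemma ulimZ a (u : nat -> R) (M : R) : (forall k, `|u k| <= M) ->
  ulim (fun k => a * u k) = a * ulim u.
Proof.
by move=> uM; apply: cvg_lim => //; apply: cvgMl_tmp; exact: cvg_ulim uM.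
Qed.

End ultralimit.

(** * One round of rounding to the dictionary *)

Section step.
Context (R : realType) (X : normedModType R).
Local Notation ell2 := (ell2 R).
Variable s : nat -> ell2.
Hypothesis s2 : forall i, `|s i| <= 2.
Hypothesis s_net : forall n, exists N, forall h, `|h| <= 1 ->
    exists2 i, (i < N)%N & `|trunc n h - s i| <= 4^-1.

Record ball_family (C : R) (m : X -> (ell2 -> R) -> R) : Prop := BallFamily {
  fam_bf : forall x, bounded_functional (C * `|x|) (m x) ;
  fam_lin : forall a x y f M, ball_bounded f M ->
    m (a *: x + y) f = a * m x f + m y f }.

(** The threshold 1/2 is twice the mesh of the net, and the least index is taken; [idx_lt] uses
    both. The default 0 is never met at truncations of points of the ball. *)
Definition idx (z : ell2) : nat :=
  if pselect (exists i, `|z - s i| <= 2^-1) is left ex then ex_minn ex else 0%N.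

Lemma idx_trunc n h : `|h| <= 1 -> `|trunc n h - s (idx (trunc n h))| <= 2^-1.
Proof.
move=> h1; rewrite /idx; case: pselect => [ex|[]]; first by case: ex_minnP.
have [N /(_ _ h1)[i _ hi]] := s_net n.
by exists i; apply: (le_trans hi); lra.
Qed.

(** A net point within 1/4 of [trunc n h] is within 1/2 of [trunc k h], so the least admissible
    index of the latter is below the bound for [n]. The point is that [N] does not depend on [k]. *)
Lemma idx_lt n : exists N, forall k h, `|h| <= 1 ->
  `|trunc k h - trunc n h| <= 4^-1 -> (idx (trunc k h) < N)%N.
Proof.
have [N HN] := s_net n; exists N => k h h1 d.
have [i iN hi] := HN _ h1.
have ki : `|trunc k h - s i| <= 2^-1.
  rewrite -[trunc k h](subrK (trunc n h)) -addrA (le_trans (ler_normD _ _))//.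
  by rewrite (le_trans (lerD d hi))//; lra.
apply: leq_ltn_trans iN; rewrite /idx; case: pselect => [ex|[]]; last by exists i.
by case: ex_minnP => j _; apply.
Qed.

(** The rounding error, doubled so as to fill the unit ball again: composing with it preserves
    bounds on the ball, hence the constant [C] of the family. *)
Definition resid k h := 2 *: (trunc k h - s (idx (trunc k h))).

Lemma residE k h n : resid k h n = 2 * (trunc k h n - s (idx (trunc k h)) n).
Proof. by []. Qed.

Lemma resid_le k h : `|h| <= 1 -> `|resid k h| <= 1.
Proof.
move=> h1; rewrite normrZ ger0_norm//.
by have := idx_trunc k h1; set v := `|_|; lra.
Qed.

Context (U : set_system nat) (UU : UltraFilter U) (subU : \oo `<=` U).
Context (C : R) (m : X -> (ell2 -> R) -> R) (fm : ball_family C m).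

Definition cell i k h : R := (idx (trunc k h) == i)%:R.

Definition coef i x := ulim U (fun k => m x (cell i k)).

Definition next_family x f := ulim U (fun k => m x (f \o resid k)).

Let cell_bd i k : ball_bounded (cell i k) 1.
Proof. by move=> h _; rewrite /cell; case: eqP; rewrite ?normr1 ?normr0. Qed.

Let m_cell i k x : `|m x (cell i k)| <= C * `|x| * 1.
Proof. exact: (bf_le (fam_bf fm x)). Qed.

Let comp_bd f M k : ball_bounded f M -> ball_bounded (f \o resid k) M.
Proof. by move=> fM h h1 /=; apply: fM; exact: resid_le. Qed.

Lemma coef_lin i a x y : coef i (a *: x + y) = a * coef i x + coef i y.
Proof.
rewrite /coef; under [X in ulim _ X]eq_fun do rewrite (fam_lin fm _ _ _ (cell_bd i _)).
exact: (ulim_lin UU a (fun k => m_cell i k x) (fun k => m_cell i k y)).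
Qed.

(** The cells are disjoint, so a combination of their indicators with signs as coefficients is
    bounded by 1. The signs are those of the limits, hence independent of [k], and can be moved
    through the ultralimit. *)
Lemma coef_sum_le N x : \sum_(i < N) `|coef i x| <= C * `|x|.
Proof.
have -> : \sum_(i < N) `|coef i x| =
    ulim U (fun k => \sum_(i < N) Num.sg (coef i x) * m x (cell i k)).
  rewrite (@ulim_sum _ _ _ _ _ (fun (i : 'I_N) k => Num.sg (coef i x) * m x (cell i k))
    (fun=> C * `|x| * 1)).
    apply: eq_bigr => i _.
    by rewrite (ulimZ UU _ (fun k => m_cell i k x)) -normrEsg.
  move=> i k; rewrite normrM; apply: le_trans (m_cell i k x).
  by rewrite ler_piMl// normr_sg; case: (_ == _).
apply: (le_trans (ler_norm _)); apply: ulim_le => k.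
rewrite -[leRHS]mulr1.
rewrite (_ : \sum_(i < N) _ = m x (fun h => \sum_(i < N) Num.sg (coef i x) * cell i k h)).
  apply: (bf_le (fam_bf fm x)) => h h1.
  have [iN|Ni] := ltnP (idx (trunc k h)) N; last first.
    rewrite big1 ?normr0// => i _; rewrite /cell (_ : (_ == _) = false) ?mulr0//.
    by rewrite gtn_eqF// (leq_trans (ltn_ord i) Ni).
  rewrite (bigD1 (Ordinal iN))// big1 => [|i /eqP ni].
    by rewrite /= addr0 /cell eqxx mulr1 normr_sg; case: (_ == _).
  rewrite /cell (_ : (_ == _) = false) ?mulr0//.
  by apply/negbTE/eqP => ni'; apply: ni; apply/val_inj.
rewrite (bf_sum (fam_bf fm x) _ (M := fun i : 'I_N => `|Num.sg (coef i x)| * 1)); last first.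
  by move=> i; apply: ball_boundedZ.
by apply: eq_bigr => i _; rewrite (bfZ (fam_bf fm x) _ (cell_bd i k)).
Qed.

Let m_next f M k x : ball_bounded f M -> `|m x (f \o resid k)| <= C * `|x| * M.
Proof. by move=> fM; apply: (bf_le (fam_bf fm x)); exact: comp_bd. Qed.

Lemma next_ball_family : ball_family C next_family.
Proof.
split => [x|a x y f M fM]; last first.
  rewrite /next_family.
  under [X in ulim _ X]eq_fun do rewrite (fam_lin fm _ _ _ (comp_bd _ fM)).
  exact: (ulim_lin UU a (fun k => m_next k x fM) (fun k => m_next k y fM)).
split => [a f g M N fM gN|f M fM]; last first.
  exact: (ulim_le UU (fun k => m_next k x fM)).
rewrite /next_family -(ulim_lin UU a (fun k => m_next k x fM) (fun k => m_next k x gN)).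
congr ulim; apply/funext => k.
by rewrite -(bf_lin (fam_bf fm x) a (comp_bd k fM) (comp_bd k gN)).
Qed.

Lemma coord_bd n : ball_bounded (fun h : ell2 => h n) 1.
Proof. by move=> h; apply: le_trans; exact: ell2_coord_le. Qed.

(** For [k > n] the coordinate [h n] is that of the chosen dictionary element plus half that of
    [resid k h]. The second part yields [next_family]. The first yields the series, up to [B k], the
    contribution of the indices from [N] on, which [variation_tail] makes small uniformly in large
    [k]. *)
Lemma step_cvg x n :
  (\sum_(i < N) coef i x * s i n) @[N --> \oo] -->
  m x (fun h : ell2 => h n) - 2^-1 * next_family x (fun h : ell2 => h n).
Proof.
apply/cvgrPdist_le => e e0.
(* The constant is 2 / (1/4)^2: [B k] is bounded by 2 and vanishes where [trunc k h] is within 1/4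
   of [trunc p h], hence it is at most 32 times the squared increment. *)
have e32 : 0 < e / 32 by rewrite divr_gt0.
have bx := fam_bf fm x.
have [p Hp] := variation_tail bx e32.
have [N0 HN0] := idx_lt p.
exists N0 => // N /= N0N.
have sn i : `|s i n| <= 2 by exact: le_trans (ell2_coord_le _ _) (s2 i).
pose A k h := \sum_(i < N) s i n * cell i k h.
pose B k h := s (idx (trunc k h)) n - A k h.
have AE k h : A k h = if (idx (trunc k h) < N)%N then s (idx (trunc k h)) n else 0.
  rewrite /A; case: ifPn => [iN|]; last first.
    rewrite -leqNgt => Ni; rewrite big1// => i _.
    rewrite /cell (_ : (_ == _) = false) ?mulr0//.
    by rewrite gtn_eqF// (leq_trans (ltn_ord i) Ni).
  rewrite (bigD1 (Ordinal iN))// big1 => [|i /eqP ni].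
    by rewrite /= addr0 /cell eqxx mulr1.
  rewrite /cell (_ : (_ == _) = false) ?mulr0//.
  by apply/negbTE/eqP => ni'; apply: ni; apply/val_inj.
have Abd k : ball_bounded (A k) 2.
  by move=> h _; rewrite AE; case: ifP => _; rewrite ?normr0.
have Bbd k : ball_bounded (B k) 2.
  by move=> h _; rewrite /B AE; case: ifP => _; rewrite ?subrr ?subr0 ?normr0.
have mA k : m x (A k) = \sum_(i < N) s i n * m x (cell i k).
  rewrite (bf_sum bx _ (M := fun i : 'I_N => `|s i n| * 1)); last first.
    by move=> i; apply: ball_boundedZ.
  by apply: eq_bigr => i _; rewrite (bfZ bx _ (cell_bd i k)).
have Bsmall k : (p <= k)%N -> `|m x (B k)| <= e.
  move=> pk.
  have b32 h : `|h| <= 1 -> `|32^-1 * B k h| <= `|trunc k h - trunc p h| ^+ 2.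
    move=> h1; have [d|d] := leP `|trunc k h - trunc p h| 4^-1.
      by rewrite /B AE ifT ?subrr ?mulr0 ?normr0 ?sqr_ge0// (leq_trans _ N0N)// HN0.
    have := Bbd k h h1; rewrite normrM ger0_norm// => hB.
    have : 4^-1 ^+ 2 <= `|trunc k h - trunc p h| ^+ 2.
      by rewrite ler_pXn2r ?nnegrE// ltW.
    rewrite expr2; move: hB; set b := `|B k h|; set q := `|_ - _| ^+ 2 => hB hq; lra.
  have := Hp _ pk _ b32; rewrite (bfZ bx _ (Bbd k)) normrM ger0_norm// => hB.
  by move: hB; set b := `|m x _| => hB; lra.
have dec k : (n < k)%N -> m x (fun h : ell2 => h n) =
    m x (A k) + m x (B k) + 2^-1 * m x ((fun h : ell2 => h n) \o resid k).
  move=> nk; rewrite -(bfZ bx _ (comp_bd k (@coord_bd n))).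
  rewrite -(bfD bx (Abd k) (Bbd k)).
  rewrite -(bfD bx (ball_boundedD (Abd k) (Bbd k)) (ball_boundedZ _ (comp_bd k (@coord_bd n)))).
  congr (m x _); apply/funext => h; rewrite -[RHS]/(A k h + B k h + 2^-1 * resid k h n).
  rewrite /B [A k h + _]addrC subrK residE truncE nk.
  by rewrite mulrA mulVf// mul1r addrC subrK.
have sumE : \sum_(i < N) coef i x * s i n = ulim U (fun k => m x (A k)).
  under [X in ulim _ X]eq_fun do rewrite mA.
  rewrite (@ulim_sum _ _ _ _ _ (fun (i : 'I_N) k => s i n * m x (cell i k))
    (fun i => `|s i n| * (C * `|x| * 1))).
    apply: eq_bigr => i _.
    by rewrite (ulimZ UU _ (fun k => m_cell i k x)) mulrC.
  by move=> i k; rewrite normrM ler_wpM2l.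
(* By [dec] this is [m x (B k)] as soon as [k > n]; smaller [k] are invisible to the ultralimit. *)
pose u k := m x (fun h : ell2 => h n) - 2^-1 * m x ((fun h : ell2 => h n) \o resid k) - m x (A k).
have cM k : `|m x ((fun h : ell2 => h n) \o resid k)| <= C * `|x| * 1.
  by apply: m_next; exact: coord_bd.
have AM k : `|m x (A k)| <= C * `|x| * 2 by exact: (bf_le bx).
have M1 : `|m x (fun h : ell2 => h n)| <= C * `|x| * 1 by exact: (bf_le bx (@coord_bd n)).
have uM k : `|u k| <= C * `|x| * 4.
  have := cM k; have := AM k; move: M1; rewrite /u !ler_norml.
  by move=> /andP[? ?] /andP[? ?] /andP[? ?]; apply/andP; split; lra.
rewrite sumE (_ : _ - _ = ulim U u).
  apply: (ulim_eventually_le UU subU uM (n := maxn p n.+1)) => k.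
  rewrite geq_max => /andP[pk nk]; rewrite /u {1}(dec _ nk).
  by rewrite addrK addrAC subrr add0r Bsmall.
apply/esym/cvg_lim => //; rewrite /u; apply: cvgB; last exact: cvg_ulim AM.
apply: cvgB; first exact: cvg_cst.
by apply: cvgMl_tmp; exact: cvg_ulim cM.
Qed.

End step.

(** * Barycenters as l1 combinations of the dictionary *)

Section representation.
Context (R : realType) (X : normedModType R).
Local Notation ell2 := (ell2 R).

Lemma cvg_big_sum (F : set_system nat) (FF : Filter F) (I : Type) (r : seq I)
    (u : I -> nat -> R) (l : I -> R) :
  (forall i, u i @ F --> l i) ->
  (fun k => \sum_(i <- r) u i k) @ F --> \sum_(i <- r) l i.
Proof.
move=> ul; elim: r => [|i r IH].
  by under eq_fun do rewrite big_nil; rewrite big_nil; exact: cvg_cst.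
by under eq_fun do rewrite big_cons; rewrite big_cons; exact: cvgD.
Qed.

Lemma geom_sum J : \sum_(j < J) (2^-1 : R) ^+ j = 2 - 2 * 2^-1 ^+ J.
Proof.
elim: J => [|J IH]; first by rewrite big_ord0 expr0 mulr1 subrr.
by rewrite big_ord_recr/= IH exprSr; lra.
Qed.

(** Each round leaves half a barycenter of a family with the same constant. After [J] rounds the
    remainder is at most [2^-1 ^+ J * (C * |x|)], and the coefficients of all rounds add up to at
    most (1 + 1/2 + 1/4 + ...) [C * |x|]. *)
Theorem ball_family_representation : exists s : nat -> ell2,
  (forall i, `|s i| <= 2) /\
  forall (C : R) (m : X -> (ell2 -> R) -> R), ball_family C m ->
  exists c : nat -> X -> R,
    [/\ forall i a x y, c i (a *: x + y) = a * c i x + c i y,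
        forall N x, \sum_(i < N) `|c i x| <= 2 * C * `|x| &
        forall x n, (\sum_(i < N) c i x * s i n) @[N --> \oo] --> m x (fun h => h n)].
Proof.
have q0 : 0 < 4^-1 :> R by rewrite invr_gt0.
have [|s [s2 snet]] := ell2_dictionary q0; first by lra.
exists s; split=> // C m0 fm0.
have [U [UU subU]] := @ultraFilterLemma _ \oo _.
pose m j := iter j (next_family s U) m0.
have fm j : ball_family C (m j) by elim: j => //= j IH; exact: next_ball_family.
pose g j i x := coef s U (m j) i x.
pose S J i x := \sum_(j < J) 2^-1 ^+ j * g j i x.
have a0 j : 0 <= 2^-1 ^+ j :> R by rewrite exprn_ge0.
have glin j i a x y : g j i (a *: x + y) = a * g j i x + g j i y.
  exact: (coef_lin s UU (fm j)).
have gle j N x : \sum_(i < N) `|g j i x| <= C * `|x| by exact: (coef_sum_le s UU (fm j)).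
have CX0 (x : X) : 0 <= C * `|x| by have := gle 0%N 0%N x; rewrite big_ord0.
have Sinc N (x : X) J J' : (J <= J')%N ->
    \sum_(i < N) `|S J' i x - S J i x| <= 2 * 2^-1 ^+ J * (C * `|x|).
  move=> JJ'.
  have SE i : S J' i x - S J i x = \sum_(J <= j < J') 2^-1 ^+ j * g j i x.
    rewrite /S -!(big_mkord xpredT (fun j => 2^-1 ^+ j * g j i x)).
    by rewrite (big_cat_nat (leq0n J) JJ')//= addrAC subrr add0r.
  under eq_bigr do rewrite SE.
  apply: (@le_trans _ _ (\sum_(J <= j < J') 2^-1 ^+ j * (C * `|x|))).
    apply: (@le_trans _ _ (\sum_(i < N) \sum_(J <= j < J') 2^-1 ^+ j * `|g j i x|)).
      apply: ler_sum => i _; apply: (le_trans (ler_norm_sum _ _ _)).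
      by apply: ler_sum => j _; rewrite normrM ger0_norm.
    rewrite exchange_big/=; apply: ler_sum => j _.
    rewrite -mulr_sumr; apply: ler_wpM2l; [exact: a0|exact: gle].
  rewrite -mulr_suml ler_wpM2r//.
  have := geom_sum J'; rewrite -(big_mkord xpredT (fun j => 2^-1 ^+ j)).
  rewrite (big_cat_nat (leq0n J) JJ')/= big_mkord geom_sum => H.
  by have := a0 J'; lra.
have SJle N (x : X) J : \sum_(i < N) `|S J i x| <= 2 * C * `|x|.
  have := Sinc N x 0%N J (leq0n J); rewrite expr0 mulr1 mulrA.
  by under eq_bigr do rewrite {2}/S big_ord0 subr0.
have Sle i (x : X) J : `|S J i x| <= 2 * C * `|x|.
  apply: le_trans (SJle i.+1 x J); rewrite big_ord_recr/= lerDr.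
  exact: sumr_ge0.
pose c i x := ulim U (fun J => S J i x).
have cS i x : (fun J => S J i x) @ U --> c i x by exact: cvg_ulim (Sle i x).
have cinc N (x : X) J : \sum_(i < N) `|c i x - S J i x| <= 2 * 2^-1 ^+ J * (C * `|x|).
  have H : (fun J' => \sum_(i < N) `|S J' i x - S J i x|) @ U -->
      \sum_(i < N) `|c i x - S J i x|.
    apply: (@cvg_big_sum U _ _ _ (fun (i : 'I_N) J' => `|S J' i x - S J i x|)) => i.
    by apply: cvg_norm; apply: cvgB; [exact: cS | exact: cvg_cst].
  rewrite -(cvg_lim _ H)//; apply: limr_le; first exact: cvgP H.
  by apply: subU; exists J => // J' /= JJ'; exact: Sinc.
exists c; split.
- move=> i a x y; rewrite /c -(ulim_lin UU a (Sle i x) (Sle i y)).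
  congr ulim; apply/funext => J; rewrite /S mulr_sumr -big_split/=.
  by apply: eq_bigr => j _; rewrite glin mulrDr mulrCA.
- move=> N x; have H : (fun J => \sum_(i < N) `|S J i x|) @ U --> \sum_(i < N) `|c i x|.
    apply: (@cvg_big_sum U _ _ _ (fun (i : 'I_N) J' => `|S J' i x|)) => i.
    by apply: cvg_norm; exact: cS.
  rewrite -(cvg_lim _ H)//; apply: limr_le; first exact: cvgP H.
  by apply: nearW => J.
- move=> x n.
  (* The equation of [step_cvg], telescoped over [J] rounds. *)
  have part J : (\sum_(i < N) S J i x * s i n) @[N --> \oo] -->
      m 0%N x (fun h => h n) - 2^-1 ^+ J * m J x (fun h => h n).
    elim: J => [|J IH].
      rewrite expr0 mul1r subrr (_ : (fun N => _) = fun=> 0); first exact: cvg_cst.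
      by apply/funext => N; rewrite big1// => i _; rewrite /S big_ord0 mul0r.
    have st := @step_cvg R X s s2 snet U UU subU C (m J) (fm J) x n.
    have st' := cvgD IH (cvgMl_tmp (a := 2^-1 ^+ J) st).
    pose f (h : ell2) := h n.
    have -> : m 0%N x f - 2^-1 ^+ J.+1 * m J.+1 x f =
        m 0%N x f - 2^-1 ^+ J * m J x f +
        2^-1 ^+ J * (m J x f - 2^-1 * next_family s U (m J) x f).
      rewrite -[next_family _ _ _]/(m J.+1) exprSr.
      by rewrite mulrBr mulrA addrA subrK.
    apply: cvg_trans (st' _ _); apply: near_eq_cvg; apply: nearW => N /=.
    rewrite fctE mulr_sumr -big_split/=; apply: eq_bigr => i _.
    by rewrite /S big_ord_recr/= mulrDl mulrA.
  apply/cvgrPdist_le => e e0.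
  (* Write [v] for [C * |x|]. Replacing [S J] by [c] costs 4 v / 2^J and dropping the remainder v /
     2^J; if 1 / 2^J is at most e / (2 (6 v + 1)), both together stay below e / 2. The summand 1
     keeps the denominator positive. *)
  have D0 : 0 < 2 * (6 * (C * `|x|) + 1).
    by rewrite mulr_gt0// ltr_wpDl// mulr_ge0.
  have e1 : 0 < e / (2 * (6 * (C * `|x|) + 1)) by rewrite divr_gt0.
  have half : `|2^-1 : R| < 1 by rewrite ger0_norm ?invr_ge0//; lra.
  have /cvgrPdist_le/(_ _ e1)[J _ /(_ J (leqnn J))/=] := cvg_expr half.
  rewrite sub0r normrN ger0_norm// => aJ.
  have e2 : 0 < e / 2 by rewrite divr_gt0.
  have /cvgrPdist_le/(_ _ e2)[N0 _ HN] := part J.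
  exists N0 => // N /HN /= {}HN.
  have b1 : `|\sum_(i < N) S J i x * s i n - \sum_(i < N) c i x * s i n| <=
      4 * 2^-1 ^+ J * (C * `|x|).
    rewrite -sumrB; apply: (le_trans (ler_norm_sum _ _ _)).
    apply: (@le_trans _ _ (\sum_(i < N) 2 * `|c i x - S J i x|)).
      apply: ler_sum => i _; rewrite -mulrBl normrM distrC mulrC ler_wpM2r//.
      exact: le_trans (ell2_coord_le _ _) (s2 i).
    by rewrite -mulr_sumr; have := cinc N x J; set u := \sum_(i < N) _; lra.
  have b2 : `|m J x (fun h => h n)| <= C * `|x| * 1.
    exact: (bf_le (fam_bf (fm J) x) (@coord_bd R n)).
  have b3 : `|2^-1 ^+ J * m J x (fun h => h n)| <= 2^-1 ^+ J * (C * `|x|).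
    by rewrite normrM ger0_norm// ler_wpM2l// -[leRHS]mulr1.
  have b4 : 2^-1 ^+ J * (5 * (C * `|x|)) <= e / 2.
    apply: (@le_trans _ _ (e / (2 * (6 * (C * `|x|) + 1)) * (5 * (C * `|x|)))).
      by rewrite ler_wpM2r// mulr_ge0.
    rewrite mulrAC ler_pdivrMr//.
    have := mulr_ge0 (ltW e0) (CX0 x); set v := C * `|x|; nra.
  move: HN b1 b3 b4; set A := m0 _ _; set B := \sum_(i < N) _ ; set D := \sum_(i < N) _.
  set G := _ * m J _ _; set v := C * `|x|; set a := 2^-1 ^+ J.
  rewrite !ler_norml => /andP[? ?] /andP[? ?] /andP[? ?] ?; apply/andP; split; lra.
Qed.
End representation.

(** * Operators through l1 *)

Section counting_L1.
Context (R : realType).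
Local Notation ell2 := (ell2 R).
Local Notation mu := (@counting nat R).
Local Notation ty := (LfunType mu (@lexx _ _ 1%E)).
Local Notation cls := (\pi_(Quotient.quot (@ae_zero _ nat R mu))%qT : ty -> L1 mu).

Lemma counting_ae (P : nat -> Prop) : (\forall n \ae mu, P n) -> forall n, P n.
Proof.
move=> [N [_ N0 NP]] n; apply: contrapT => nPn.
have Nn : N n by exact: NP.
suff : (1 <= mu N :> \bar R)%E by rewrite N0 lee_fin ler10.
have <- : mu [set n] = 1%E :> \bar R.
  by rewrite /counting asboolT// fset_set1 finmap.cardfs1.
by apply: le_measure; rewrite ?inE// => _ ->.
Qed.

(** The empty set is the only null set of the counting measure, so classes can be handled as
    sequences. *)
Lemma L1_counting_repr (f : ty) n : (repr (cls f) : ty) n = f n.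
Proof.
have := L1_repr f; rewrite inE/= => /counting_ae/(_ n).
by rewrite -[LHS]/((repr (cls f) : ty) n - f n) => /subr0_eq.
Qed.

Lemma L1_counting_reprP (a : R) (p q : L1 mu) n :
  (repr (a *: p + q) : ty) n = a * (repr p : ty) n + (repr q : ty) n.
Proof.
rewrite -[p]reprK -[q]reprK; set f := repr p; set g := repr q.
rewrite -[_ *: _]/(L1_scale _ _) L1_scale_cls -clsD !L1_counting_repr.
by [].
Qed.

Lemma L1_counting_norm (q : L1 mu) :
  (`|q|%:E = \sum_(0 <= k <oo) `|(repr q : ty) k|%:E)%E.
Proof.
rewrite -[`|q|]/(L1_norm q) finite_norm_fine Lnorm1 ge0_integral_count//.
Qed.

Lemma L1_counting_sum_le (q : L1 mu) N : \sum_(i < N) `|(repr q : ty) i| <= `|q|.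
Proof.
rewrite -lee_fin L1_counting_norm -sumEFin.
rewrite -(big_mkord xpredT (fun k => (`|(repr q : ty) k|%:E)%E)).
by apply: nneseries_lim_ge => k _ _; rewrite lee_fin.
Qed.

Lemma counting_Lfun1 (u : nat -> R) (M : R) :
  (forall N, \sum_(i < N) `|u i| <= M) ->
  exists2 f : ty, (forall n, f n = u n) & `|cls f| <= M.
Proof.
move=> uM.
have sM : (\sum_(0 <= k <oo) `|u k|%:E <= M%:E)%E.
  apply: lime_le; first by apply: is_cvg_nneseries => k _ _; rewrite lee_fin.
  by apply: nearW => n; rewrite sumEFin lee_fin big_mkord.
suff uL : u \in Lfun mu 1%E.
  exists (Lfun_Sub (@lexx _ _ 1%E) uL) => //.
  rewrite -lee_fin L1_counting_norm; apply: le_trans sM.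
  rewrite le_eqVlt; apply/orP; left; apply/eqP; apply: eq_eseriesr => k _.
  by rewrite L1_counting_repr.
rewrite inE; apply/andP; split; rewrite inE//=.
rewrite /finite_norm Lnorm1 ge0_integral_count//.
exact: le_lt_trans sM (ltry _).
Qed.

Section synthesis.
Variable s : nat -> ell2.
Hypothesis s2 : forall i, `|s i| <= 2.

Let sn i n : `|s i n| <= 2.
Proof. exact: le_trans (ell2_coord_le _ _) (s2 i). Qed.

Lemma synthesis_cvg (q : L1 mu) n :
  cvg ((\sum_(i < N) (repr q : ty) i * s i n) @[N --> \oo]).
Proof.
have : cvgn [normed series (fun i => (repr q : ty) i * s i n)].
  apply: nondecreasing_is_cvgn.
    by apply: nondecreasing_series => i _ _; exact: normr_ge0.
  exists (`|q| * 2) => _ [N _ <-]; rewrite /normed_series_of seriesEord/=.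
  apply: (@le_trans _ _ (\sum_(i < N) `|(repr q : ty) i| * 2)).
    by apply: ler_sum => i _; rewrite normrM ler_wpM2l.
  by rewrite -mulr_suml ler_wpM2r// L1_counting_sum_le.
move=> /normed_cvg; rewrite (_ : series _ = fun N =>
  \sum_(i < N) (repr q : ty) i * s i n) //.
by apply/funext => N; rewrite /series/= big_mkord.
Qed.

Let lims (q : L1 mu) n := limn (fun N => \sum_(i < N) (repr q : ty) i * s i n).

(** The partial sums are vectors of norm at most [2 * |q|], and a bound on finitely many coordinates
    passes to the limit. *)
Let lims_sqr (q : L1 mu) n : \sum_(k < n) (lims q k) ^+ 2 <= (2 * `|q|) ^+ 2.
Proof.
have H : (fun N => \sum_(k < n) (\sum_(i < N) (repr q : ty) i * s i k) ^+ 2) @ \oo -->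
    \sum_(k < n) (lims q k) ^+ 2.
  apply: (@cvg_big_sum _ _ _ _ _
    (fun (k : 'I_n) N => (\sum_(i < N) (repr q : ty) i * s i k) ^+ 2)).
  by move=> k; rewrite expr2; under eq_fun do rewrite expr2; apply: cvgM; exact: synthesis_cvg.
rewrite -(cvg_lim _ H)//; apply: limr_le; first exact: cvgP H.
apply: nearW => N.
pose v : ell2 := \sum_(i < N) (repr q : ty) i *: s i.
have vk k : v k = \sum_(i < N) (repr q : ty) i * s i k by rewrite ell2_sum.
under eq_bigr do rewrite -vk.
apply: (le_trans (ell2_sum_sqr_le v n)); rewrite ler_pXn2r ?nnegrE ?mulr_ge0//.
apply: (le_trans (ler_norm_sum _ _ _)).
apply: (@le_trans _ _ (\sum_(i < N) 2 * `|(repr q : ty) i|)).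
  by apply: ler_sum => i _; rewrite normrZ mulrC ler_wpM2r.
by rewrite -mulr_sumr ler_wpM2l// L1_counting_sum_le.
Qed.

Lemma L1_synthesis : exists B : L1 mu ->b ell2, `|B| <= 2 /\
  forall q n, (\sum_(i < N) (repr q : ty) i * s i n) @[N --> \oo] --> B q n.
Proof.
have /choice[B BE] := fun q => ell2_build (lims_sqr q).
have Blin : linear B.
  move=> a p q; apply: ell2P => n; rewrite ell2D ell2Z !BE.
  apply: cvg_lim => //.
  apply: cvg_trans (_ : (fun N => a * \sum_(i < N) (repr p : ty) i * s i n +
     \sum_(i < N) (repr q : ty) i * s i n) @ \oo --> _).
    apply: near_eq_cvg; apply: nearW => N; rewrite mulr_sumr -big_split/=.
    by apply: eq_bigr => i _; rewrite L1_counting_reprP mulrDl mulrA.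
  by apply: cvgD; [apply: cvgMl_tmp|]; exact: synthesis_cvg.
have Ble q : `|B q| <= 2 * `|q|.
  apply: ell2_norm_le; first by rewrite mulr_ge0.
  by move=> n; under eq_bigr do rewrite BE; exact: lims_sqr.
pose Bl := GRing.isLinear.Build R (L1 mu) ell2 *:%R B Blin.
pose BL : {linear L1 mu -> ell2} := HB.pack B Bl.
have mB : (BL : L1 mu -> ell2) \in @is_bop R (L1 mu) ell2 by exact: (@mem_bop _ _ _ BL 2 Ble).
exists (Bop mB); split; first exact: opnorm_le.
by move=> q n; rewrite /= BE; exact: synthesis_cvg.
Qed.

End synthesis.

Lemma L1_analysis (X : normedModType R) (c : nat -> X -> R) (M : R) : 0 <= M ->
  (forall i a x y, c i (a *: x + y) = a * c i x + c i y) ->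
  (forall N x, \sum_(i < N) `|c i x| <= M * `|x|) ->
  exists A : X ->b L1 mu, `|A| <= M /\ forall x i, (repr (A x) : ty) i = c i x.
Proof.
move=> M0 clin cM.
have H x : exists f : ty, (forall n, f n = c n x) /\ `|cls f| <= M * `|x|.
  by have [f ? ?] := @counting_Lfun1 (fun i => c i x) _ (fun N => cM N x); exists f.
have /choice[f fE] := H.
pose A x := cls (f x).
have Alin : linear A.
  move=> a x y; rewrite /A -[a *: cls _]/(L1_scale a (cls (f x))) L1_scale_cls -clsD.
  congr cls; apply/val_inj/funext => n /=.
  by rewrite (fE _).1 clin -!(fE _).1.
have Ale x : `|A x| <= M * `|x| by exact: (fE x).2.
pose Al := GRing.isLinear.Build R X (L1 mu) *:%R A Alin.
pose AL : {linear X -> L1 mu} := HB.pack A Al.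
have mA : (AL : X -> L1 mu) \in @is_bop R X (L1 mu) by exact: (@mem_bop _ _ _ AL M Ale).
exists (Bop mA); split; first exact: opnorm_le.
by move=> x i; rewrite /= L1_counting_repr (fE x).1.
Qed.

End counting_L1.

(** * Extension by the Hahn-Banach theorem *)

Section tensors.
Context (R : realType) (X : normedModType R).
Local Notation ell2 := (ell2 R).

(** [tensor_cost G c] certifies a decomposition of [G] into finitely many elementary tensors of
    total cost [c], so the infimum of the costs is the projective norm. Tensors are kept as
    functions of [h], which makes two decompositions of the same tensor equal by construction. *)
Inductive tensor_cost : (ell2 -> X) -> R -> Prop :=
| TensorCost0 : tensor_cost (fun=> 0) 0
| TensorCostS f M y G c : ball_bounded f M -> tensor_cost G c ->
    tensor_cost (fun h => f h *: y + G h) (M * `|y| + c).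

Lemma tensor_cost_ge0 G c : tensor_cost G c -> 0 <= c.
Proof.
elim=> // f M y {}G {}c fM _ c0; rewrite addr_ge0// mulr_ge0//.
exact: ball_bounded_ge0 fM.
Qed.

Lemma tensor_costD G c H d : tensor_cost G c -> tensor_cost H d ->
  tensor_cost (fun h => G h + H h) (c + d).
Proof.
move=> + Hd; elim=> [|f M y {}G {}c fM _ IH].
  by rewrite add0r; under eq_fun do rewrite add0r.
rewrite -addrA; under eq_fun do rewrite -addrA.
exact: TensorCostS.
Qed.

Lemma tensor_costZ a G c : tensor_cost G c -> tensor_cost (fun h => a *: G h) (`|a| * c).
Proof.
elim=> [|f M y {}G {}c fM _ IH].
  by rewrite mulr0; under eq_fun do rewrite scaler0; exact: TensorCost0.
rewrite mulrDr mulrA; under eq_fun do rewrite scalerDr scalerA.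
by apply: TensorCostS => //; exact: ball_boundedZ.
Qed.

Definition is_tensor : {pred ell2 -> X} := mem [set G | exists c, tensor_cost G c].

Lemma is_tensor_submod_closed : submod_closed is_tensor.
Proof.
split; first by rewrite inE; exists 0; exact: TensorCost0.
move=> a G H; rewrite !inE => -[c Gc] [d Hd]; exists (`|a| * c + d).
by apply: tensor_costD => //; exact: tensor_costZ.
Qed.

HB.instance Definition _ :=
  GRing.isSubmodClosed.Build R (ell2 -> X) is_tensor is_tensor_submod_closed.

Record tensor := Tensor { tensor_fun :> ell2 -> X ; _ : tensor_fun \in is_tensor }.

HB.instance Definition _ := [isSub for tensor_fun].
HB.instance Definition _ := [Choice of tensor by <:].
HB.instance Definition _ := [SubChoice_isSubLmodule of tensor by <:].

Lemma tensorP (G : tensor) : exists c, tensor_cost G c.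
Proof. by have := valP G; rewrite inE. Qed.

Section seminorm.
Variable C : R.
Hypothesis C0 : 0 <= C.

(** The factor [C] is included so that this is the sublinear majorant handed to [hahn_banach]. *)
Definition projective_norm (G : tensor) : R := inf [set C * c | c in tensor_cost G].

Lemma projective_norm_le (G : tensor) c : tensor_cost G c -> projective_norm G <= C * c.
Proof.
move=> Gc; apply: ge_inf; last by exists c.
by exists 0 => _ [d /tensor_cost_ge0 d0 <-]; exact: mulr_ge0.
Qed.

Lemma projective_norm_ge (G : tensor) r :
  (forall c, tensor_cost G c -> r <= C * c) -> r <= projective_norm G.
Proof.
move=> rG; apply: lb_le_inf; last by move=> _ [c Gc <-]; exact: rG.
by have [c Gc] := tensorP G; exists (C * c), c.
Qed.

Lemma projective_normD (G H : tensor) :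
  projective_norm (G + H) <= projective_norm G + projective_norm H.
Proof.
rewrite -lerBlDr; apply: projective_norm_ge => c Gc.
rewrite lerBlDr -lerBlDl; apply: projective_norm_ge => d Hd.
by rewrite lerBlDl -mulrDr; apply: projective_norm_le; exact: tensor_costD.
Qed.

Let projective_normZ_le a (G : tensor) : 0 < a ->
  projective_norm (a *: G) <= a * projective_norm G.
Proof.
move=> a0; rewrite -ler_pdivrMl//; apply: projective_norm_ge => c Gc.
rewrite ler_pdivrMl// mulrCA -[a in a * c]gtr0_norm//.
by apply: projective_norm_le; exact: tensor_costZ.
Qed.

Lemma projective_normZ a (G : tensor) : 0 < a ->
  projective_norm (a *: G) = a * projective_norm G.
Proof.
move=> a0; apply/le_anti; rewrite projective_normZ_le//=.
rewrite -ler_pdivlMl//.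
rewrite -[X in projective_norm X <= _](scale1r G) -(mulVf (lt0r_neq0 a0)) -scalerA.
by apply: projective_normZ_le; rewrite invr_gt0.
Qed.

End seminorm.

(** * The trace form and its extension *)

Section extension.
Context (E : submodClosed X) (S : subsp E -> ell2) (C : R).
Hypothesis Slin : linear S.
Hypothesis C0 : 0 <= C.
Hypothesis S_le : forall N (x : nat -> subsp E) c,
  tensor_cost (fun h => \sum_(n < N) h n *: val (x n)) c -> \sum_(n < N) S (x n) n <= C * c.

(** These are the tensors of l2 and [E]. Since [x] vanishes from [N] on, it can be recovered from
    [G] by evaluation at the unit vectors, so the trace does not depend on the representation. *)
Definition repr_by (G : tensor) (N : nat) (x : nat -> subsp E) :=
  (forall n, (N <= n)%N -> x n = 0) /\ forall h, G h = \sum_(n < N) h n *: val (x n).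

Let S0 : S 0 = 0.
Proof.
have := Slin 1 0 0; rewrite scaler0 addr0 scale1r => /eqP.
by rewrite -subr_eq subrr => /eqP.
Qed.

Lemma repr_byE G N x n : repr_by G N x -> G (e_ R n) = val (x n).
Proof.
move=> [x0 GE]; rewrite GE; have [nN|Nn] := ltnP n N.
  rewrite (bigD1 (Ordinal nN))// big1 => [|i /eqP ni].
    by rewrite e_E eqxx scale1r /= addr0.
  rewrite e_E (_ : (_ == _) = false) ?scale0r//.
  by apply/negbTE/eqP => ni'; apply: ni; apply/val_inj.
rewrite x0// big1// => i _; rewrite e_E (_ : (_ == _) = false) ?scale0r//.
by rewrite ltn_eqF// (leq_trans (ltn_ord i) Nn).
Qed.

Let widen (V : zmodType) (F : nat -> V) N K : (N <= K)%N ->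
  (forall n, (N <= n)%N -> F n = 0) -> \sum_(n < N) F n = \sum_(n < K) F n.
Proof.
move=> NK F0; rewrite -!(big_mkord xpredT F) (big_cat_nat (leq0n N) NK)/=.
by rewrite [X in _ + X]big_nat_cond [X in _ + X]big1 ?addr0// => i /andP[/andP[Ni _] _]; exact: F0.
Qed.

Lemma repr_by_widen G N x K : (N <= K)%N -> repr_by G N x -> repr_by G K x.
Proof.
move=> NK [x0 GE]; split=> [n Kn|h]; first by apply: x0; exact: leq_trans Kn.
rewrite GE; apply: (widen (F := fun n => h n *: val (x n)) NK) => n /x0 ->.
by rewrite scaler0.
Qed.

Definition trace_form (G : tensor) : R :=
  if pselect (exists Nx, repr_by G Nx.1 Nx.2) is left ex then
    let Nx := projT1 (cid ex) in \sum_(n < Nx.1) S (Nx.2 n) n else 0.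

Lemma trace_formE G N x : repr_by G N x -> trace_form G = \sum_(n < N) S (x n) n.
Proof.
move=> GNx; rewrite /trace_form; case: pselect => [ex|[]]; last by exists (N, x).
case: (cid ex) => -[K y] /= GKy.
have xy : y = x.
  by apply/funext => n; apply: val_inj; rewrite -(repr_byE n GKy) -(repr_byE n GNx).
rewrite xy in GKy *.
rewrite (widen (F := fun n => S (x n) n) (leq_maxl K N)); last first.
  by move=> n /GKy.1 ->; rewrite S0.
rewrite [RHS](widen (F := fun n => S (x n) n) (leq_maxr K N))//.
by move=> n /GNx.1 ->; rewrite S0.
Qed.

(** The elementary tensor of [f] and [y]. The default 0 may occur only when [f] is unbounded on the
    ball, where the value of the functional is irrelevant. *)
Definition pure (f : ell2 -> R) (y : X) : tensor := insubd (0 : tensor) (fun h => f h *: y).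

Lemma pure_cost f M y : ball_bounded f M -> tensor_cost (fun h => f h *: y) (M * `|y|).
Proof.
move=> fM; have := TensorCostS y fM TensorCost0.
by rewrite addr0; under eq_fun do rewrite addr0.
Qed.

Lemma pureE f M y : ball_bounded f M -> pure f y = (fun h => f h *: y) :> (ell2 -> X).
Proof.
move=> fM; rewrite /pure insubdK// inE.
by exists (M * `|y|); exact: pure_cost.
Qed.

Lemma extension_family : exists m, ball_family C m /\
  forall (x : subsp E) n, m (val x) (fun h => h n) = S x n.
Proof.
pose W : set tensor := [set G | exists N x, repr_by G N x].
have Wlin a u v N x K y : repr_by u N x -> repr_by v K y ->
    repr_by (a *: u + v) (maxn N K) (fun n => a *: x n + y n).
  move=> /(repr_by_widen (leq_maxl N K))[x0 uE] /(repr_by_widen (leq_maxr N K))[y0 vE].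
  split=> [n n0|h]; first by rewrite x0// y0// scaler0 addr0.
  rewrite -[LHS]/(a *: u h + v h) uE vE scaler_sumr -big_split/=.
  by apply: eq_bigr => n _; rewrite scalerDr !scalerA mulrC.
have [||||F [Flin FW Fp]] := @hahn_banach R tensor (projective_norm C)
    (projective_normD C0) (projective_normZ C0) W trace_form.
- by exists 0%N, (fun=> 0); split => // h; rewrite big_ord0.
- by move=> a u v [N [x ux]] [K [y vy]]; exists (maxn N K), (fun n => a *: x n + y n); exact: Wlin.
- move=> a u v [N [x ux]] [K [y vy]].
  rewrite (trace_formE (Wlin a _ _ _ _ _ _ ux vy)).
  rewrite (trace_formE (repr_by_widen (leq_maxl N K) ux)).
  rewrite (trace_formE (repr_by_widen (leq_maxr N K) vy)).
  rewrite mulr_sumr -big_split/=; apply: eq_bigr => n _.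
  by rewrite Slin.
- move=> u [N [x ux]]; rewrite (trace_formE ux); apply: projective_norm_ge => c uc.
  by apply: S_le; rewrite (_ : (fun h => _) = u)//; apply/funext => h; rewrite ux.2.
have F0 : F 0 = 0.
  by have := Flin 1 0 0; rewrite scale1r addr0 mul1r => /eqP; rewrite -subr_eq subrr => /eqP.
pose m x f := F (pure f x).
exists m; split; last first.
  move=> x n; pose y k := if k == n then x else 0.
  have cb := @coord_bd R n.
  (* The coordinate functional tensored with a vector of [E] is a tensor over [E] with a single
     entry, in slot [n]; its trace is [S x n]. *)
  have rep : repr_by (pure (fun h : ell2 => h n) (val x)) n.+1 y.
    split=> [k nk|h]; first by rewrite /y gtn_eqF.
    rewrite (pureE _ cb) (bigD1 ord_max)//= big1 ?addr0 /y ?eqxx// => i /eqP ni.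
    rewrite ifF ?scaler0//; apply/negbTE/eqP => ni'; apply: ni; exact/val_inj.
  rewrite /m FW; last by exists n.+1, y.
  rewrite (trace_formE rep) (bigD1 ord_max)//= big1 ?addr0 /y ?eqxx// => i /eqP ni.
  by rewrite ifF ?S0//; apply/negbTE/eqP => ni'; apply: ni; exact/val_inj.
have Fcost f M y : ball_bounded f M -> F (pure f y) <= C * (M * `|y|).
  move=> fM; apply: le_trans (Fp _) _; apply: projective_norm_le => //.
  by rewrite (pureE _ fM); exact: pure_cost.
have mlin a f g M N x : ball_bounded f M -> ball_bounded g N ->
    m x (fun h => a * f h + g h) = a * m x f + m x g.
  move=> fM gN; rewrite /m -Flin; congr F; apply/val_inj => /=.
  have agb := ball_boundedD (ball_boundedZ a fM) gN.
  rewrite (pureE _ agb); apply/funext => h.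
  rewrite -[RHS]/(a *: pure f x h + pure g x h) (pureE _ fM) (pureE _ gN).
  by rewrite scalerDl scalerA.
split=> [x|a x y f M fM].
  split=> [a f g M N|f M fM]; first exact: mlin.
  have b0 : ball_bounded (fun=> 0 : R) 0 by move=> h _; rewrite normr0.
  have p0 : pure (fun=> 0) x = 0.
    by apply/val_inj; rewrite /= (pureE _ b0); apply/funext => h; rewrite scale0r.
  rewrite ler_norml lerNl -mulrA [`|x| * M]mulrC; apply/andP; split; last exact: Fcost.
  (* [hahn_banach] bounds [F] from above only; the lower bound is the upper bound at the opposite
     function. *)
  have -> : - m x f = m x (fun h => -1 * f h + 0).
    by rewrite (mlin _ _ _ _ _ _ fM b0) {3}/m p0 F0 addr0 mulN1r.
  apply: Fcost => h h1; rewrite addr0 mulN1r normrN; exact: fM.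
rewrite /m -Flin; congr F; apply/val_inj => /=.
rewrite (pureE _ fM); apply/funext => h.
rewrite -[RHS]/(a *: pure f x h + pure f y h) !(pureE _ fM).
by rewrite scalerDr !scalerA mulrC.
Qed.

End extension.
End tensors.

(** * Trace duality *)

Section L1_integration.
Import HBSimple.
Context d (Y : measurableType d) (R : realType) (nu : {measure set Y -> \bar R}).
Local Notation ty := (LfunType nu (@lexx _ _ 1%E)).
Local Notation cls := (\pi_(Quotient.quot (@ae_zero _ Y R nu))%qT : ty -> L1 nu).

Lemma L1_integrable (f : ty) : nu.-integrable setT (EFin \o f).
Proof. by apply/Lfun1_integrable; exact: LfunP. Qed.

Lemma norm_clsE (f : ty) : (`|cls f|%:E = \int[nu]_x `|f x|%:E)%E.
Proof.
rewrite -[`|_|]/(L1_norm _) L1_norm_cls finite_norm_fine Lnorm1.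
by apply: eq_integral.
Qed.

Lemma L1_scaleE a (f : ty) : a *: cls f = cls (a *: f).
Proof. by rewrite -L1_scale_cls. Qed.

Lemma L1_integral_functional (Q : set Y) : measurable Q ->
  exists J : L1 nu ->b R^o, forall f : ty, J (cls f) = \int[nu]_(x in Q) f x.
Proof.
move=> mQ.
pose J (q : L1 nu) : R^o := \int[nu]_(x in Q) (repr q : ty) x.
have mf (f : ty) : measurable_fun Q (EFin \o f).
  exact: (measurable_funS measurableT (@subsetT _ _) (measurable_int _ (L1_integrable f))).
have Jcls f : J (cls f) = \int[nu]_(x in Q) f x.
  congr fine; apply: ae_eq_integral => //; [exact: mf|exact: mf|].
  have := L1_repr f; rewrite inE/=; apply: filterS => x fx _ /=.
  by congr EFin; apply/eqP; rewrite -subr_eq0; apply/eqP.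
have intQ (f : ty) : nu.-integrable Q (EFin \o f).
  exact: (integrableS measurableT mQ (@subsetT _ _) (L1_integrable f)).
have Jlin : linear J.
  move=> a p q; rewrite -[p]reprK -[q]reprK; set f := repr p; set g := repr q.
  rewrite L1_scaleE -clsD !Jcls.
  rewrite -[RHS]/(a * \int[nu]_(x in Q) f x + \int[nu]_(x in Q) g x).
  by rewrite -(RintegralZl a mQ (intQ f)) -(RintegralD mQ (intQ (a *: f)) (intQ g)).
have Jle q : `|J q| <= 1 * `|q|.
  rewrite mul1r -[q]reprK; set f := repr q; rewrite Jcls.
  apply: le_trans (le_normr_Rintegral mQ (intQ f)) _.
  rewrite -lee_fin norm_clsE /Rintegral fineK; last first.
    apply: integrable_fin_num => //.
    exact: (integrable_norm (intQ f)).
  apply: ge0_subset_integral => //.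
  exact: (measurable_int _ (integrable_norm (L1_integrable f))).
pose Jl := GRing.isLinear.Build R (L1 nu) R^o *:%R J Jlin.
pose JL : {linear L1 nu -> R^o} := HB.pack J Jl.
have mJ : (JL : L1 nu -> R^o) \in @is_bop R (L1 nu) R^o.
  by exact: (@mem_bop _ _ _ JL 1 Jle).
by exists (Bop mJ).
Qed.

Lemma L1_sum_integral_le (I : eqType) (s : seq I) (Q : I -> set Y) (J : I -> L1 nu ->b R^o) :
  (forall i, measurable (Q i)) -> uniq s -> trivIset [set` s] Q ->
  (forall i (f : ty), J i (cls f) = \int[nu]_(x in Q i) f x) ->
  forall p, \sum_(i <- s) `|J i p| <= `|p|.
Proof.
move=> mQ us tQ JE p; rewrite -[p]reprK; set f := repr p.
have mf A : measurable A -> measurable_fun A (fun x => `|f x|%:E).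
  move=> mA; apply: (measurable_funS measurableT (@subsetT _ _)).
  exact: (measurable_int _ (integrable_norm (L1_integrable f))).
rewrite -lee_fin norm_clsE -sumEFin.
apply: (@le_trans _ _ (\sum_(i <- s) \int[nu]_(x in Q i) `|f x|%:E)%E).
  apply: lee_sum => i _; rewrite JE.
  have iQ : nu.-integrable (Q i) (EFin \o f).
    exact: (integrableS measurableT (mQ i) (@subsetT _ _) (L1_integrable f)).
  have := le_normr_Rintegral (mQ i) iQ; rewrite -lee_fin => h; apply: (le_trans h).
  rewrite /Rintegral fineK//; apply: integrable_fin_num => //.
  exact: (integrable_norm iQ).
have mD : measurable (\big[setU/set0]_(i <- s) Q i) by exact: bigsetU_measurable.
rewrite -(ge0_integral_bigsetU nu mQ us tQ)//=; last exact: mf.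
apply: ge0_subset_integral => //; exact: mf.
Qed.

(* The metric approximation property of L1, through finite-dimensional l1. *)
Lemma L1_finite_approx (N : nat) (q : nat -> L1 nu) (e : R) : 0 < e ->
  exists (I : Type) (s : seq I) (J : I -> L1 nu ->b R^o) (u : I -> L1 nu),
    [/\ forall v, `|u v| <= 1,
        forall p, \sum_(v <- s) `|J v p| <= `|p| &
        forall n, (n < N)%N -> `|q n - \sum_(v <- s) J v (q n) *: u v| <= e].
Proof.
move=> e0.
have e20 : 0 < e / 2 by rewrite divr_gt0.
have /choice[g gP] : forall n : nat, exists g : {sfun Y >-> R},
    nu.-integrable setT (EFin \o (g : Y -> R)) /\
    (\int[nu]_x `|(repr (q n) : ty) x - g x|%:E <= (e / 2)%:E)%E.
  move=> n; have [g [gi _ gc]] := approximation_sfun_integrable measurableT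
    (L1_integrable (repr (q n))).
  have /fine_cvgP[fnum /cvgrPdist_le/(_ _ e20)] := gc.
  move=> H; have [m [/= fm Hm]] : exists m,
      (\int[nu]_(z in setT) `|((repr (q n) : ty) z)%:E - (g m z)%:E|)%E \is a fin_num /\
      `|0 - fine (\int[nu]_(z in setT) `|((repr (q n) : ty) z)%:E - (g m z)%:E|)%E| <= e / 2.
    have [k _ Hk] := filterI fnum H.
    by exists k; exact: (Hk k (leqnn k)).
  exists (g m); split => //.
  move: Hm; rewrite sub0r normrN => /(le_trans (ler_norm _)).
  by rewrite -lee_fin fineK.
(* The [N] simple functions are read as one vector-valued function. Its level sets form a finite
   measurable partition on whose pieces each [g n] is constant. *)
pose G y : {ffun 'I_N -> R} := [ffun n : 'I_N => g n y].
pose Q (v : {ffun 'I_N -> R}) := G @^-1` [set v].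
have QE v : Q v = \bigcap_(n in [set: 'I_N]) (g n @^-1` [set v n]).
  apply/seteqP; split => [y <- n _ /=|y yv]; first by rewrite /G ffunE.
  by apply/ffunP => n; rewrite ffunE; exact: yv n I.
have mQ v : measurable (Q v).
  rewrite QE; apply: fin_bigcap_measurable => [|n _]; first exact: finite_finset.
  rewrite -[X in measurable X]setTI.
  by apply: (measurable_funPT (g n)).
have fG : finite_set (range G).
  pose r n := finmap.enum_fset (fset_set (range (g n))).
  pose K := (\max_(n < N) size (r n)).+1.
  apply: (@sub_finite_set _ _
    ((fun v : {ffun 'I_N -> 'I_K} => [ffun n : 'I_N => nth 0 (r n) (v n)]) @` setT)).
    move=> _ [y _ <-].
    have gr (n : 'I_N) : g n y \in r n.
      by rewrite in_fset_set ?inE//; exists y.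
    exists [ffun n : 'I_N => inord (index (g n y) (r n))] => //.
    apply/ffunP => n; rewrite !ffunE inordK; first by rewrite nth_index.
    rewrite ltnS (leq_trans (index_size _ _))//.
    exact: (leq_bigmax (F := fun n : 'I_N => size (r n))).
  by apply: finite_image; exact: finite_finset.
pose s := finmap.enum_fset (fset_set (range G)).
have us : uniq s by exact: finmap.fset_uniq.
have Gs y : G y \in s by rewrite in_fset_set ?inE//; exists y.
have tQ : trivIset [set` s] Q.
  by move=> v w _ _ [y []]; rewrite /Q /= => <- <-.
have /choice[J JE] := fun v => L1_integral_functional (mQ v).
(* A piece may have infinite measure, as [nu] is arbitrary; it receives the zero class. By
   integrability all the [g n] with [n < N] vanish there ([vfin]), so nothing is lost. *)
have indP v : exists w : ty,
    if (nu (Q v) < +oo)%E then w = \1_(Q v) :> (Y -> R) else w = 0.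
  have [fin|nfin] := boolP (nu (Q v) < +oo)%E; last by exists 0.
  have L : (\1_(Q v) : Y -> R) \in Lfun nu 1%E.
    apply/Lfun1_integrable/integrableP; split.
      by apply/measurable_EFinP; exact: measurable_indic.
    under eq_integral do rewrite /= ger0_norm//.
    by rewrite integral_indic// setIT.
  by exists (Lfun_Sub (@lexx _ _ 1%E) L).
have {indP} /choice[w wP] := indP.
pose m v := `|cls (w v)|.
have mE v : (nu (Q v) < +oo)%E -> (m v)%:E = nu (Q v).
  move=> fin; have := wP v; rewrite fin => wE; rewrite /m norm_clsE wE.
  under eq_integral do rewrite /= ger0_norm//.
  by rewrite integral_indic// setIT.
have gL n : (g n : Y -> R) \in Lfun nu 1%E by apply/Lfun1_integrable; exact: (gP n).1.
pose gam n : ty := Lfun_Sub (@lexx _ _ 1%E) (gL n).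
have vfin (v : {ffun 'I_N -> R}) (n : 'I_N) : v n != 0 -> (nu (Q v) < +oo)%E.
  move=> vn; have /integrableP[_ gfin] := (gP n).1.
  have : (`|v n|%:E * nu (Q v) < +oo)%E.
    apply: le_lt_trans gfin; rewrite -[X in nu X]setIT -integral_indic//.
    rewrite -ge0_integralZl//; last first.
      by apply/measurable_EFinP; exact: measurable_indic.
    apply: ge0_le_integral => //.
    - by apply/measurable_EFinP; apply: measurable_funM => //; exact: measurable_indic.
    - by apply: (measurable_int _ (integrable_norm (gP n).1)).
    move=> y _ /=; rewrite -EFinM lee_fin indicE.
    have [yQ|_] := boolP (y \in Q v); last by rewrite mulr0.
    by move: yQ; rewrite inE => <-; rewrite mulr1 ffunE.
  have [//|] := ltP (nu (Q v)) +oo%E; rewrite leye_eq => /eqP ->.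
  by rewrite mulry gtr0_sg ?normr_gt0// mul1e.
have Jgam (v : {ffun 'I_N -> R}) (n : 'I_N) : J v (cls (gam n)) = v n * m v.
  rewrite JE (_ : \int[nu]_(x in Q v) gam n x = \int[nu]_(x in Q v) (v n)).
    have [->|vn] := eqVneq (v n) 0.
      by rewrite mul0r /Rintegral integral0.
    by rewrite Rintegral_cst//; congr (_ * _); rewrite -(mE _ (vfin _ _ vn)).
  by apply: eq_Rintegral => y; rewrite inE => <-; rewrite ffunE.
have gamE (n : 'I_N) : cls (gam n) = \sum_(v <- s) v n *: cls (w v).
  have -> : \sum_(v <- s) v n *: cls (w v) = cls (\sum_(v <- s) v n *: w v).
    elim: (s) => [|v t IH]; last by rewrite !big_cons IH L1_scaleE clsD.
    rewrite !big_nil; apply: (@addrI _ (cls 0)); by rewrite addr0 -clsD addr0.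
  congr cls; apply/val_inj/funext => y /=.
  have sumE (F : {ffun 'I_N -> R} -> ty) (t : seq _) :
      (\sum_(v <- t) F v : ty) y = \sum_(v <- t) F v y.
    by elim: t => [|v t IH]; rewrite ?big_nil// !big_cons -IH.
  rewrite -[RHS]/((\sum_(v <- s) v n *: w v : ty) y) sumE.
  rewrite (bigD1_seq (G y))//= big1 => [|v vG].
    rewrite addr0 -[RHS]/(G y n * w (G y) y) ffunE.
    have [->|gn] := eqVneq (g n y) 0; first by rewrite mul0r.
    have := wP (G y); rewrite (vfin (G y) n) ?ffunE// => ->.
    by rewrite indicE mem_set ?mulr1.
  rewrite -[LHS]/(v n * w v y); have := wP v; case: ifPn => _ ->; last by rewrite mulr0.
  by rewrite indicE memNset ?mulr0// => /esym/eqP; rewrite (negbTE vG).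
pose u v := (m v)^-1 *: cls (w v).
have u1 v : `|u v| <= 1.
  rewrite normrZ -/(m v) normfV [`|m v|]ger0_norm; last exact: normr_ge0.
  have [->|mv] := eqVneq (m v) 0; first by rewrite mulr0.
  by rewrite mulVf.
have Jle p : \sum_(v <- s) `|J v p| <= `|p| by exact: L1_sum_integral_le us tQ JE p.
(* Averaging over the pieces of the partition: a contraction that fixes each [gam n] with [n < N].
   Hence the error at [q n] is at most twice its distance to [gam n]. *)
pose P p := \sum_(v <- s) J v p *: u v.
have PB p r : P p - P r = P (p - r).
  by rewrite /P -sumrB; apply: eq_bigr => v _; rewrite linearB scalerBl.
have Ple p : `|P p| <= `|p|.
  apply: le_trans (Jle p); apply: (le_trans (ler_norm_sum _ _ _)); apply: ler_sum => v _.
  by rewrite normrZ ler_piMr.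
have Pgam (n : 'I_N) : P (cls (gam n)) = cls (gam n).
  rewrite [RHS]gamE; apply: eq_bigr => v _; rewrite Jgam /u scalerA -mulrA.
  have [mv|mv] := eqVneq (m v) 0; last by rewrite divff ?mulr1.
  by have /normr0_eq0 -> : `|cls (w v)| = 0 by []; rewrite !scaler0.
exists {ffun 'I_N -> R}, s, J, u; split => // n nN.
pose k := Ordinal nN.
have dk : `|q n - cls (gam k)| <= e / 2.
  rewrite -[q n]reprK -lee_fin.
  have -> : cls (repr (q n)) - cls (gam k) = cls (repr (q n) - gam k).
    by rewrite -scaleN1r L1_scaleE -clsD scaleN1r.
  by rewrite norm_clsE; exact: (gP n).2.
rewrite -/(P (q n)).
have -> : q n - P (q n) = (q n - cls (gam k)) + P (cls (gam k) - q n).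
  by rewrite -PB Pgam addrA subrK.
rewrite (le_trans (ler_normD _ _))// [leRHS]splitr lerD//.
by apply: le_trans (Ple _) _; rewrite distrC.
Qed.

End L1_integration.

(** * Operator norms, the 1-summing norm and the trace pairing *)

Section bounded_operator_norm.
Context (R : realType) (V W : normedModType R).

Lemma opnorm_le_ball (f : V ->b W) (M : R) :
  (forall x, `|x| <= 1 -> `|f x| <= M) -> `|f| <= M.
Proof.
move=> fM; apply: ge_sup; first exact: (opnorm_has_sup f).1.
by move=> _ [x /= x1 <-]; exact: fM.
Qed.

Lemma bop_le (f : V ->b W) x : `|f x| <= `|f| * `|x|.
Proof. exact: ler_opnorm. Qed.

End bounded_operator_norm.

Section summing_norm.
Context (R : realType) (V W : normedModType R).

Lemma weak_l1_has_sup (s : seq V) : has_sup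
  [set \sum_(x <- s) `|f x| | f in [set f : V ->b R^o | `|f| <= 1]].
Proof.
split; first by exists (\sum_(x <- s) `|(0 : V ->b R^o) x|), 0; rewrite //= normr0.
exists (\sum_(x <- s) `|x|) => _ [f /= f1 <-]; apply: ler_sum => x _.
by apply: (le_trans (bop_le f x)); rewrite ler_piMl.
Qed.

Lemma weak_l1_ge (s : seq V) (f : V ->b R^o) : `|f| <= 1 ->
  \sum_(x <- s) `|f x| <= weak_l1_norm s.
Proof.
move=> f1; apply: ub_le_sup; first by case: (weak_l1_has_sup s).
by exists f.
Qed.

Lemma weak_l1_ge0 (s : seq V) : 0 <= weak_l1_norm s.
Proof.
apply: le_trans (weak_l1_ge s (f := 0) _); last by rewrite normr0.
exact: sumr_ge0.
Qed.

Lemma weak_l1_le (s : seq V) (M : R) :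
  (forall f : V ->b R^o, `|f| <= 1 -> \sum_(x <- s) `|f x| <= M) -> weak_l1_norm s <= M.
Proof.
move=> H; apply: ge_sup; first by case: (weak_l1_has_sup s).
by move=> _ [f /= f1 <-]; exact: H.
Qed.

Lemma sum_weak_l1_le (s : seq V) (f : V ->b R^o) :
  \sum_(x <- s) `|f x| <= `|f| * weak_l1_norm s.
Proof.
have [f0|f0] := eqVneq `|f| 0.
  rewrite f0 mul0r big1// => x _; apply/le_anti; rewrite normr_ge0 andbT.
  by apply: (le_trans (bop_le f x)); rewrite f0 mul0r.
rewrite -ler_pdivrMl ?lt_def ?f0 ?normr_ge0//.
have := @weak_l1_ge s (`|f|^-1 *: f); rewrite normrZ normfV normr_id mulVf// => /(_ (lexx _)).
rewrite mulr_sumr; apply: le_trans; rewrite le_eqVlt; apply/orP; left; apply/eqP.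
apply: eq_bigr => x _; rewrite -[(_ *: f) x]/(`|f|^-1 *: f x : R^o).
by rewrite normrZ normfV normr_id.
Qed.

Lemma pi1_le (u : V ->b W) (C : R) : 0 <= C ->
  (forall s : seq V, \sum_(x <- s) `|u x| <= C * weak_l1_norm s) -> (pi1 u <= C%:E)%E.
Proof. by move=> C0 uC; apply: ereal_inf_lbound; exists C. Qed.

Lemma pi1_sum_le (u : V ->b W) (C : R) (s : seq V) : (pi1 u <= C%:E)%E ->
  \sum_(x <- s) `|u x| <= C * weak_l1_norm s.
Proof.
move=> uC; apply/ler_addgt0Pr => e e0.
have w0 := weak_l1_ge0 s.
have e1 : 0 < e / (weak_l1_norm s + 1) by rewrite divr_gt0// ltr_wpDl.
have : (pi1 u < (C + e / (weak_l1_norm s + 1))%:E)%E.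
  by rewrite (le_lt_trans uC)// lte_fin ltrDl.
move=> /ereal_inf_lt [_ [D [D0 uD] <-]]; rewrite lte_fin => DC.
apply: (le_trans (uD s)); apply: (@le_trans _ _ ((C + e / (weak_l1_norm s + 1)) * weak_l1_norm s)).
  by rewrite ler_wpM2r// ltW.
rewrite mulrDl lerD2l mulrAC ler_pdivrMr ?ltr_wpDl// ler_wpM2l ?(ltW e0)//.
by rewrite lerDl.
Qed.

Lemma pi1_ge0 (u : V ->b W) : (0 <= pi1 u)%E.
Proof. by apply/ereal_infP => _ [C [C0 _] <-]; rewrite lee_fin. Qed.

End summing_norm.

Section trace_duality.
Context (R : realType) (V : normedModType R).
Context d (Y : measurableType d) (nu : {measure set Y -> \bar R}).
Context (A : V ->b L1 nu) (B : L1 nu ->b ell2 R).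

(** When [A] is replaced by its finite-rank approximation, the trace becomes the sum of the
    [adjoint T (j v) (B (u v))]. The 1-summing inequality applies to the functionals [j v], whose
    weak l1 norm is at most the norm of [A]. The approximation error is spread over the [N]
    terms. *)
Lemma trace_duality (T : ell2 R ->b V) (N : nat) (x : nat -> V) (C : R) :
  (forall h, T h = \sum_(n < N) h n *: x n) ->
  (pi1 (adjoint T) <= C%:E)%E ->
  \sum_(n < N) B (A (x n)) n <= `|A| * `|B| * C.
Proof.
move=> TE TC; apply/ler_addgt0Pr => e e0.
have D0 : 0 < N%:R * `|B| + 1 :> R by rewrite ltr_wpDl// mulr_ge0.
have e1 : 0 < e / (N%:R * `|B| + 1) by rewrite divr_gt0.
have [I [s [J [u [u1 Jle qu]]]]] := L1_finite_approx N (fun n => A (x n)) e1.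
pose j v : dual V := bop_comp (J v) A.
have jE v y : j v y = J v (A y) by [].
have C0 : 0 <= C by rewrite -lee_fin (le_trans (pi1_ge0 _) TC).
(* A functional [F] on the dual is tested on one element, the combination of the [j v] with the
   signs of [F (j v)], whose norm is at most that of [A]. *)
have wj : weak_l1_norm [seq j v | v <- s] <= `|A|.
  apply: weak_l1_le => F F1; rewrite big_map.
  pose g : dual V := \sum_(v <- s) Num.sg (F (j v)) *: j v.
  have -> : \sum_(v <- s) `|F (j v)| = F g.
    rewrite linear_sum; apply: eq_bigr => v _; rewrite linearZ/=.
    by rewrite -[RHS]/(Num.sg (F (j v)) * F (j v)) -normrEsg.
  apply: (le_trans (ler_norm _)); apply: (le_trans (bop_le F g)).
  apply: (@le_trans _ _ `|g|); first by rewrite ler_piMl.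
  apply: opnorm_le => // y.
  have gE : g y = \sum_(v <- s) Num.sg (F (j v)) * j v y.
    rewrite /g; elim: (s) => [|v t IH]; first by rewrite !big_nil.
    by rewrite !big_cons -IH.
  rewrite gE; apply: le_trans (bop_le A y); apply: le_trans (Jle (A y)).
  apply: (le_trans (ler_norm_sum _ _ _)); apply: ler_sum => v _.
  by rewrite normrM jE ler_piMl// normr_sg; case: (_ == _).
pose P y := \sum_(v <- s) J v (A y) *: u v.
have split n : B (A (x n)) n = B (P (x n)) n + B (A (x n) - P (x n)) n.
  by rewrite linearB ell2D ell2N addrC subrK.
rewrite (eq_bigr _ (fun (n : 'I_N) _ => split n)) big_split/=; apply: lerD; last first.
  apply: (@le_trans _ _ (\sum_(n < N) `|B| * (e / (N%:R * `|B| + 1)))).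
    apply: ler_sum => n _; apply: (le_trans (ler_norm _)).
    apply: (le_trans (ell2_coord_le _ _)); apply: (le_trans (bop_le B _)).
    by rewrite ler_wpM2l// qu.
  rewrite sumr_const card_ord -[leLHS]mulr_natl !mulrA ler_pdivrMr//.
  by rewrite mulrDr mulr1 [e * _]mulrC lerDl ltW.
have -> : \sum_(n < N) B (P (x n)) n = \sum_(v <- s) adjoint T (j v) (B (u v)).
  transitivity (\sum_(n < N) \sum_(v <- s) J v (A (x n)) * B (u v) n).
    apply: eq_bigr => n _; rewrite /P linear_sum ell2_sum.
    by apply: eq_bigr => v _; rewrite linearZ ell2Z.
  rewrite exchange_big/=; apply: eq_bigr => v _.
  rewrite -[RHS]/(j v (T (B (u v)))) TE linear_sum; apply: eq_bigr => n _.
  by rewrite linearZ mulrC.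
apply: (@le_trans _ _ (\sum_(v <- s) `|adjoint T (j v)| * `|B|)).
  apply: ler_sum => v _; apply: (le_trans (ler_norm _)).
  apply: (le_trans (bop_le _ _)); rewrite ler_wpM2l//.
  by apply: (le_trans (bop_le _ _)); rewrite ler_piMr.
rewrite -mulr_suml mulrC mulrAC [`|A| * C]mulrC mulrC ler_wpM2r//.
have := pi1_sum_le [seq j v | v <- s] TC; rewrite big_map => /le_trans; apply.
by rewrite ler_wpM2l.
Qed.

End trace_duality.

(** * The 1-summing norm against the projective norm *)

Section tensor_bound.
Context (R : realType) (X : normedModType R).
Local Notation ell2 := (ell2 R).

Lemma eval_sum_le (s : seq (dual X)) (y : X) :
  \sum_(f <- s) `|f y| <= `|y| * weak_l1_norm s.
Proof.
pose ev (f : dual X) : R^o := f y.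
have evlin : linear ev by [].
have evle f : `|ev f| <= `|y| * `|f| by rewrite mulrC; exact: (bop_le f y).
pose evl := GRing.isLinear.Build R (dual X) R^o *:%R ev evlin.
pose evL : {linear dual X -> R^o} := HB.pack ev evl.
have mev : (evL : dual X -> R^o) \in @is_bop R (dual X) R^o.
  by exact: (@mem_bop _ _ _ evL `|y| evle).
have := sum_weak_l1_le s (Bop mev) => /le_trans; apply.
by rewrite ler_wpM2r ?weak_l1_ge0//; exact: opnorm_le.
Qed.

(** The majorant [b f] does not depend on [h], so the supremum over the ball is taken before the sum
    over [f]. For a decomposition with bounds [M] and vectors [y] it is the sum of the [M * |f y|],
    and evaluation at [y] is a functional on the dual. *)
Lemma tensor_cost_weak_le (s : seq (dual X)) (G : ell2 -> X) c : tensor_cost G c ->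
  exists b : dual X -> R, (forall (f : dual X) h, `|h| <= 1 -> `|f (G h)| <= b f) /\
    \sum_(f <- s) b f <= c * weak_l1_norm s.
Proof.
elim=> [|g M y {}G {}c gM _ [b [fb bs]]].
  exists (fun=> 0); split; first by move=> f h _; rewrite linear0 normr0.
  by rewrite big1// mul0r.
exists (fun f : dual X => M * `|f y| + b f); split.
  move=> f h h1; rewrite linearD linearZ (le_trans (ler_normD _ _))// lerD ?fb//.
  by rewrite normrM ler_wpM2r// gM.
rewrite big_split/= mulrDl lerD// -mulr_sumr -mulrA ler_wpM2l ?(ball_bounded_ge0 gM)//.
exact: eval_sum_le.
Qed.

Lemma pi1_adjoint_tensor_le (E : submodClosed X) (T : ell2 ->b subsp E) c :
  tensor_cost (fun h => val (T h)) c ->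
  (pi1 (bop_comp (adjoint T) (quotient_map E)) <= c%:E)%E.
Proof.
move=> Tc; apply: pi1_le; first exact: tensor_cost_ge0 Tc.
move=> s; have [b [fb bs]] := tensor_cost_weak_le s Tc.
apply: le_trans bs; apply: ler_sum => f _.
by apply: opnorm_le_ball => h h1; exact: fb.
Qed.

End tensor_bound.

(** * Gaussian sums *)

Section integral_density.
Import HBNNSimple.
Local Open Scope ereal_scope.
Context d d' (X : measurableType d) (Y : measurableType d') (R : realType).
Context (mu : {measure set X -> \bar R}) (nu : {measure set Y -> \bar R}).
Context (w : X -> R) (xi : X -> Y) (c : R).
Hypothesis mw : measurable_fun setT w.
Hypothesis w0 : forall x, (0 <= w x)%R.
Hypothesis mxi : measurable_fun setT xi.
Hypothesis density : forall A, measurable A ->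
  \int[mu]_(x in xi @^-1` A) (w x)%:E = c%:E * nu A.

Let mpre A : measurable A -> measurable (xi @^-1` A).
Proof. by move=> mA; rewrite -[X in measurable X]setTI; exact: mxi. Qed.

Let indicZ (A : set Y) (k : R) : measurable A -> (0 <= k)%R ->
  \int[mu]_x (w x * (k * \1_A (xi x)))%:E = c%:E * (k%:E * nu A).
Proof.
move=> mA k0.
transitivity (k%:E * \int[mu]_(x in xi @^-1` A) (w x)%:E); last by rewrite density// muleCA.
rewrite [in RHS]integral_mkcond -ge0_integralZl//.
- apply: eq_integral => x _; rewrite patchE indicE.
  have [xA|xA] := boolP (x \in xi @^-1` A).
    by rewrite mem_set ?mulr1; [rewrite -EFinM mulrC | by move: xA; rewrite inE].
  rewrite mule0 memNset ?mulr0//; by move: xA; rewrite notin_setE.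
- apply/(measurable_restrictT _ (mpre mA)).
  by apply: (measurable_funS measurableT) => //; exact/measurable_EFinP.
- by move=> x _; rewrite patchE; case: ifP => // _; rewrite lee_fin.
Qed.

(** [density] says that the image under [xi] of the measure with density [w] is [c] times [nu];
    simple functions and monotone convergence carry this from sets to functions. With [xi] the
    identity it gives Gaussian integrals, and with [w] a product of other factors it gives
    independence. *)
Lemma integral_density (phi : Y -> R) : measurable_fun setT phi ->
  (forall y, (0 <= phi y)%R) ->
  \int[mu]_x (w x * phi (xi x))%:E = c%:E * \int[nu]_y (phi y)%:E.
Proof.
move=> mphi phi0.
have mphi' : measurable_fun setT (EFin \o phi) by exact/measurable_EFinP.
have phi0' y : [set: Y] y -> 0 <= (EFin \o phi) y by rewrite lee_fin.
pose f := nnsfun_approx measurableT mphi'.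
have mf n : measurable_fun setT (fun x => (w x * f n (xi x))%:E).
  apply/measurable_EFinP; apply: measurable_funM => //.
  by apply: (measurableT_comp _ mxi); exact: measurable_funP.
have -> : \int[mu]_x (w x * phi (xi x))%:E = limn (fun n => \int[mu]_x (w x * f n (xi x))%:E).
  rewrite -monotone_convergence//.
  - apply: eq_integral => x _; apply/esym/cvg_lim => //.
    rewrite EFinM; under eq_fun do rewrite EFinM.
    by apply: cvgeZl => //; exact: (cvg_nnsfun_approx measurableT mphi' phi0').
  - by move=> n x _; rewrite lee_fin mulr_ge0.
  - move=> x _ n m nm; rewrite lee_fin ler_wpM2l//.
    exact/lefP/nd_nnsfun_approx.
have -> : \int[nu]_y (phi y)%:E = limn (fun n => \int[nu]_y (f n y)%:E).
  rewrite -monotone_convergence//.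
  - apply: eq_integral => x _; apply/esym/cvg_lim => //.
    exact: (cvg_nnsfun_approx measurableT mphi' phi0').
  - by move=> n; apply/measurable_EFinP; exact: measurable_funP.
  - by move=> n x _; rewrite lee_fin.
  - by move=> x _ n m nm; rewrite lee_fin; exact/lefP/nd_nnsfun_approx.
have step n : \int[mu]_x (w x * f n (xi x))%:E = c%:E * \int[nu]_y (f n y)%:E.
  transitivity (\sum_(k \in range (f n))
      \int[mu]_x (w x * (k * \1_(f n @^-1` [set k]) (xi x)))%:E).
    rewrite -ge0_integral_fsum//.
    - apply: eq_integral => x _; rewrite fimfunE EFinM.
      rewrite -fsumEFin// ge0_mule_fsumr; last first.
        by move=> r; rewrite nnfun_muleindic_ge0.
      by apply: eq_fsbigr => r _; rewrite EFinM.
    - move=> r; apply/measurable_EFinP; apply: measurable_funM => //.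
      apply: measurable_funM => //.
      by apply: (measurableT_comp _ mxi); exact: measurable_indic.
    - by move=> r x _; rewrite !EFinM mule_ge0 ?nnfun_muleindic_ge0// lee_fin.
  rewrite integralT_nnsfun.
  transitivity (\sum_(k \in range (f n)) c%:E * (k%:E * nu (f n @^-1` [set k]))).
    apply: eq_fsbigr => k; rewrite inE => -[y _ <-]; exact: indicZ.
  rewrite sintegralE ge0_mule_fsumr//; last by move=> r; exact: nnsfun_mulemu_ge0.
under eq_fun do rewrite step.
apply/cvg_lim => //; apply: cvgeZl => //.
apply: ereal_nondecreasing_is_cvgn => n m nm; apply: ge0_le_integral => //.
- by move=> y _; rewrite lee_fin.
- by apply/measurable_EFinP; exact: measurable_funP.
- by apply/measurable_EFinP; exact: measurable_funP.
- by move=> y _; rewrite lee_fin; exact/lefP/nd_nnsfun_approx.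
Qed.
End integral_density.

(** * Products of independent variables and exponential moments *)

Section independence.
Local Open Scope ereal_scope.
Context d (Omega : measurableType d) (R : realType) (P : probability Omega R).
Context (g : nat -> {RV P >-> R}).
Hypothesis indep : mutually_independent g.
Context (phi : nat -> R -> R) (v : nat -> R).
Hypothesis mphi : forall n, measurable_fun setT (phi n).
Hypothesis phi0 : forall n x, (0 <= phi n x)%R.
Hypothesis phiE : forall n, \int[P]_t (phi n (g n t))%:E = (v n)%:E.

Let mg n : measurable_fun setT (g n). Proof. exact: measurable_funP. Qed.

Let event (t : seq nat) (A : nat -> set R) := \bigcap_(m in [set` t]) (g m @^-1` A m).

Let mevent t A : (forall n, measurable (A n)) -> measurable (event t A).
Proof.
move=> mA; apply: fin_bigcap_measurable; first exact: finite_seq.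
by move=> m _; rewrite -[X in measurable X]setTI; exact: mg.
Qed.

Let mprod (s : seq nat) : measurable_fun setT (fun t => \prod_(n <- s) phi n (g n t))%R.
Proof.
elim: s => [|n s IH]; first by under eq_fun do rewrite big_nil; exact: measurable_cst.
under eq_fun do rewrite big_cons; apply: measurable_funM => //.
exact: (measurableT_comp (mphi n) (mg n)).
Qed.

Let prod0 (s : seq nat) t : (0 <= \prod_(n <- s) phi n (g n t))%R.
Proof. by apply: prodr_ge0 => n _; exact: phi0. Qed.

(** Mixing events and functions allows an induction that moves one index at a time. With [n] among
    the events, the induction hypothesis says that under the weight [w] the variable [g n] has a
    multiple of its own law; [integral_density] then replaces the event by [phi n]. *)
Lemma independent_prod_event (s t : seq nat) (A : nat -> set R) :
  uniq (s ++ t) -> (forall n, measurable (A n)) ->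
  \int[P]_(x in event t A) (\prod_(n <- s) phi n (g n x))%:E =
  (\prod_(n <- s) v n)%:E * \prod_(m <- t) P (g m @^-1` A m).
Proof.
elim: s t A => [|n s IH] t A /=.
  move=> ut mA; rewrite big_nil mul1e -indep//.
  under eq_integral do rewrite big_nil.
  by rewrite integral_cst ?mul1e//; exact: mevent.
rewrite mem_cat negb_or => /andP[/andP[ns nt] ust] mA.
pose w x : R := (\1_(event t A) x * \prod_(n <- s) phi n (g n x))%R.
have Pfin : (\prod_(m <- t) P (g m @^-1` A m)) \is a fin_num.
  elim: (t) => [|m t' IH']; first by rewrite big_nil.
  by rewrite big_cons fin_numM// fin_num_measure// -[X in measurable X]setTI; exact: mg.
pose c := (\prod_(n <- s) v n * fine (\prod_(m <- t) P (g m @^-1` A m)))%R.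
have mw : measurable_fun setT w.
  by apply: measurable_funM => //; apply: measurable_indic; exact: mevent.
have w0 x : (0 <= w x)%R by rewrite mulr_ge0.
have dens B : measurable B ->
    \int[P]_(x in g n @^-1` B) (w x)%:E = c%:E * distribution P (g n) B.
  move=> mB; pose A' m := if m == n then B else A m.
  have mA' m : measurable (A' m) by rewrite /A'; case: ifP.
  have u' : uniq (s ++ n :: t).
    rewrite (perm_uniq (permEl (perm_catCA s [:: n] t)))/= mem_cat negb_or ns nt.
    exact: ust.
  have := IH (n :: t) A' u' mA'.
  rewrite big_cons (_ : A' n = B); last by rewrite /A' eqxx.
  have -> : \prod_(m <- t) P (g m @^-1` A' m) = \prod_(m <- t) P (g m @^-1` A m).
    apply: eq_big_seq => m mt; rewrite /A' ifF//.
    by apply/negbTE; apply: contraNN nt => /eqP <-.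
  rewrite /c EFinM fineK// -muleA [X in _ = _ * X -> _]muleC => <-.
  have -> : event (n :: t) A' = g n @^-1` B `&` event t A.
    apply/seteqP; split => x.
      move=> xA; split.
        by have := xA n; rewrite /= mem_head /A' eqxx; exact.
      move=> m /= mt; have := xA m; rewrite /= inE mt orbT /A' => /(_ isT).
      by rewrite ifF//; apply/negbTE; apply: contraNN nt => /eqP <-.
    move=> [xB xA] m /=; rewrite inE /A'; case: eqP => [-> _ //|_] /= mt.
    exact: xA.
  rewrite integral_mkcondr; apply: eq_integral => x _.
  by rewrite patchE /w indicE; case: ifP => _; rewrite ?mul1r ?mul0r.
have := integral_density mw w0 (mg n) dens (mphi n) (phi0 n).
rewrite ge0_integral_distribution; first last.
- by move=> y; rewrite lee_fin.
- exact/measurable_EFinP.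
rewrite phiE => E; rewrite big_cons.
transitivity (\int[P]_x (w x * phi n (g n x))%:E).
  rewrite integral_mkcond; apply: eq_integral => x _.
  rewrite patchE /w indicE big_cons; case: ifP => _; last by rewrite !mul0r.
  by rewrite mul1r mulrC.
by rewrite E /c !EFinM fineK// muleC muleA.
Qed.

Lemma independent_prod (N : nat) :
  \int[P]_x (\prod_(n < N) phi n (g n x))%:E = (\prod_(n < N) v n)%:E.
Proof.
have := @independent_prod_event (index_iota 0 N) [::] (fun=> setT).
rewrite cats0 iota_uniq big_nil mule1 big_mkord => /(_ isT (fun=> measurableT)) <-.
rewrite /event (_ : \bigcap_(m in _) _ = setT); last by rewrite -subTset => x _ m.
by apply: eq_integral => x _; rewrite big_mkord.
Qed.

End independence.

Section gaussian_mgf.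
Local Open Scope ereal_scope.
Context d (Omega : measurableType d) (R : realType) (P : probability Omega R).
Context (g : nat -> {RV P >-> R}).
Hypothesis std : standard_gaussian_sequence g.

Lemma gaussian_mgf n (a : R) :
  \int[P]_t (expR (a * g n t))%:E = (expR (a ^+ 2 / 2))%:E.
Proof.
have mE : measurable_fun setT (fun x : R => expR (a * x)).
  by apply: measurableT_comp => //; exact: measurable_funM.
have := @ge0_integral_distribution _ _ _ _ _ P (g n) (fun x => (expR (a * x))%:E).
rewrite /comp/= => <-; first last.
- by move=> y; rewrite lee_fin expR_ge0.
- exact/measurable_EFinP.
have dens A : measurable A -> \int[lebesgue_measure]_(x in idfun @^-1` A) (normal_pdf 0 1 x)%:E =
    1%:E * distribution P (g n) A.
  by move=> mA; rewrite mul1e std.2.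
have := @integral_density _ _ _ _ R (@lebesgue_measure R) (distribution P (g n))
  (normal_pdf 0 1) idfun 1 (measurable_normal_pdf 0 1) (normal_pdf_ge0 0 1)
  (@measurable_id _ _ setT) dens _ mE (fun x => expR_ge0 _).
rewrite mul1e => <-.
(* Completing the square: the exponential factor turns the standard density into [expR (a ^+ 2 / 2)]
   times the density centred at [a]. *)
transitivity (\int[lebesgue_measure]_x ((expR (a ^+ 2 / 2))%:E * (normal_pdf a 1 x)%:E)).
  apply: eq_integral => x _; rewrite -EFinM; congr EFin.
  rewrite !normal_pdfE ?oner_eq0// /normal_fun -mulrA -expRD.
  rewrite [RHS]mulrCA -expRD; congr (_ * expR _)%R.
  by rewrite expr1n /=; field.
rewrite ge0_integralZl//.
- by rewrite integral_normal_pdf mule1.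
- by apply/measurable_EFinP; exact: measurable_normal_pdf.
- by move=> x _; rewrite lee_fin normal_pdf_ge0.
Qed.

Lemma gaussian_sum_mgf (a : nat -> R) (N : nat) :
  \int[P]_t (expR (\sum_(n < N) a n * g n t))%:E =
  (expR ((\sum_(n < N) a n ^+ 2) / 2))%:E.
Proof.
under eq_integral do rewrite expR_sum.
rewrite (@independent_prod _ _ _ _ _ std.1 (fun n x => expR (a n * x))
  (fun n => expR (a n ^+ 2 / 2))).
- by rewrite mulr_suml expR_sum.
- by move=> n; apply: measurableT_comp => //; exact: measurable_funM.
- by move=> n x; exact: expR_ge0.
- by move=> n; exact: gaussian_mgf.
Qed.

End gaussian_mgf.

(** * The first absolute moment of a Gaussian combination *)

Section gaussian_abs.
Context (R : realType).

(* With [u := cosh s - 1] this reads [u / 7 - u ^+ 2 / 42 <= `|s|]; the left-hand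
   side only involves exponential moments of a Gaussian variable and has a
   positive mean. *)
Lemma abs_ge_exp (s : R) : 2 / 21 * (expR s + expR (- s)) <=
  `|s| + (168^-1 * (expR (2 * s) + expR (- (2 * s))) + 5 / 28).
Proof.
have [E1 E2] : expR s + expR (- s) = expR `|s| + expR (- `|s|) /\
    expR (2 * s) + expR (- (2 * s)) = expR `|s| ^+ 2 + expR (- `|s|) ^+ 2.
  rewrite -!expRM_natl; case: (ger0P s) => _; first by rewrite mulrN.
  by rewrite !opprK mulrN [X in X = _ /\ _]addrC [X in _ /\ X = _]addrC.
rewrite {}E1 {}E2.
set M := expR `|s|; set m := expR (- `|s|).
have Mm : M * m = 1 by rewrite -expRD subrr expR0.
have s0 : 0 <= `|s| by [].
have m1 : 1 - `|s| <= m by exact: expR_ge1Dx.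
have M1 : 1 <= M by rewrite -expR0 ler_expR.
have m0 : 0 < m by exact: expR_gt0.
move: s0 m1; set v := `|s| => s0 m1.
have mM : m <= 1 by nra.
(* With u = (M + m) / 2 - 1 the lower bound for [v] is u (6 - u) / 42, which is negative once M + m
   exceeds 14. *)
have [u6|u6] := leP (M + m) 14; last by nra.
(* That is, (1 - v) (1 + u) <= 1, hence v >= u / (1 + u), which exceeds u (6 - u) / 42 because (6 -
   u) (1 + u) <= 42. *)
have k : (1 - v) * (M + m) <= 2.
  have [v1|v1] := leP v 1; last by nra.
  have : (1 - v) * (M + m) <= m * (M + m) by rewrite ler_wpM2r//; nra.
  nra.
nra.
Qed.

Lemma expR_half_bounds : let x : R := expR 2^-1 in 1 < x /\ x <= 2.
Proof.
split; first by rewrite expR_gt1 invr_gt0.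
have h : 2^-1 <= expR (- 2^-1) :> R.
  by apply: le_trans (expR_ge1Dx _); lra.
have := expRxMexpNx_1 (2^-1 : R); have := expR_gt0 (2^-1 : R).
by move: h; set x := expR 2^-1; set y := expR _ => ? ? ?; nra.
Qed.

(** The mean of the lower bound in [abs_ge_exp] at a standard Gaussian. With [x = expR 2^-1] the
    exponential moments at 1 and 2 are [x] and [x ^+ 4], and 4 x / 21 - x^4 / 84 - 5 / 28 results.
    The exact moment is the square root of 2 / pi. *)
Definition gauss_const : R := (16 * expR 2^-1 - expR 2^-1 ^+ 4 - 15) / 84.

Lemma gauss_const_gt0 : 0 < gauss_const.
Proof.
have [x1 x2] := expR_half_bounds; rewrite divr_gt0//; set x := expR _ in x1 x2 *.
(* For [x <= 2] the second factor is at least 15 - 2 - 4 - 8 = 1. *)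
have -> : 16 * x - x ^+ 4 - 15 = (x - 1) * (15 - x - x ^+ 2 - x ^+ 3) by ring.
rewrite mulr_gt0 ?subr_gt0//.
have : x ^+ 2 <= 4 by rewrite (_ : 4 = 2 ^+ 2) ?ler_pXn2r ?nnegrE//; [lra | ring].
have : x ^+ 3 <= 8 by rewrite (_ : 8 = 2 ^+ 3) ?ler_pXn2r ?nnegrE//; [lra | ring].
lra.
Qed.

Local Open Scope ereal_scope.
Context d (Omega : measurableType d) (P : probability Omega R).
Context (g : nat -> {RV P >-> R}).
Hypothesis std : standard_gaussian_sequence g.

Lemma measurable_gauss_comb (a : nat -> R) (N : nat) :
  measurable_fun setT (fun t => (\sum_(n < N) a n * g n t)%R).
Proof. by apply: measurable_sum => n; apply: measurable_funM. Qed.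

Lemma gauss_comb_cosh (a : nat -> R) (N : nat) (t c k : R) :
  (\sum_(n < N) a n ^+ 2 = 1)%R -> (0 <= c)%R -> (0 <= k)%R ->
  \int[P]_w (c * (expR (t * (\sum_(n < N) a n * g n w)) +
                  expR (- (t * (\sum_(n < N) a n * g n w)))) + k)%:E =
  (2 * c * expR (t ^+ 2 / 2) + k)%:E.
Proof.
move=> a1 c0 k0.
have mE (b : R) : measurable_fun setT (fun w => (expR (b * (\sum_(n < N) a n * g n w)))%:E).
  apply/measurable_EFinP; apply: measurableT_comp => //; apply: measurable_funM => //.
  exact: measurable_gauss_comb.
have IE (b : R) : \int[P]_w (expR (b * (\sum_(n < N) a n * g n w)))%:E = (expR (b ^+ 2 / 2))%:E.
  transitivity (\int[P]_w (expR (\sum_(n < N) (b * a n) * g n w))%:E).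
    apply: eq_integral => w _; rewrite mulr_sumr; do 2 congr (_ _).
    by apply: eq_bigr => n _; rewrite mulrA.
  rewrite (gaussian_sum_mgf std (fun n => b * a n)%R); under eq_bigr do rewrite exprMn.
  by rewrite -mulr_sumr a1 mulr1.
under eq_integral do rewrite -mulNr EFinD EFinM EFinD.
rewrite ge0_integralD//; first last.
- by apply: emeasurable_funM => //; apply: emeasurable_funD; exact: mE.
- by move=> w _; rewrite -EFinD -EFinM lee_fin mulr_ge0// addr_ge0// expR_ge0.
rewrite ge0_integralZl//; first last.
- by move=> w _; rewrite -EFinD lee_fin addr_ge0// expR_ge0.
- by apply: emeasurable_funD; exact: mE.
rewrite ge0_integralD//; try exact: mE; try by move=> w _; rewrite lee_fin expR_ge0.
rewrite !IE integral_cst//= probability_setT mule1 -!(EFinD, EFinM) ?sqrrN.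
by congr EFin; ring.
Qed.

Lemma gauss_abs_ge1 (a : nat -> R) (N : nat) : (\sum_(n < N) a n ^+ 2 = 1)%R ->
  gauss_const%:E <= \int[P]_w `|\sum_(n < N) a n * g n w|%:E.
Proof.
move=> a1; set S := fun w => (\sum_(n < N) a n * g n w)%R.
have mS : measurable_fun setT S by exact: measurable_gauss_comb.
have c1 : (0 <= 2 / 21 :> R)%R by [].
have c2 : (0 <= 168^-1 :> R)%R by [].
have c3 : (0 <= 5 / 28 :> R)%R by [].
have I1 := gauss_comb_cosh 1 a1 c1 (lexx 0%R).
have I2 := gauss_comb_cosh 2 a1 c2 c3.
have mcosh (t c k : R) : measurable_fun setT
    (fun w => (c * (expR (t * S w) + expR (- (t * S w))) + k)%:E).
  apply/measurable_EFinP; apply: measurable_funD => //; apply: measurable_funM => //.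
  apply: measurable_funD; apply: measurableT_comp => //; first exact: measurable_funM.
  by apply: measurableT_comp => //; exact: measurable_funM.
have mabs : measurable_fun setT (fun w => `|S w|%:E).
  by apply/measurable_EFinP; exact: measurableT_comp.
have pos (t c k : R) w : (0 <= c)%R -> (0 <= k)%R ->
    (0 <= c * (expR (t * S w) + expR (- (t * S w))) + k)%R.
  by move=> ? ?; rewrite addr_ge0// mulr_ge0// addr_ge0// expR_ge0.
(* The negative terms stand on the right, as in [abs_ge_exp], so that only integrals of nonnegative
   functions occur. *)
have : \int[P]_w (2 / 21 * (expR (1 * S w) + expR (- (1 * S w))) + 0)%:E <=
    \int[P]_w (`|S w|%:E + (168^-1 * (expR (2 * S w) + expR (- (2 * S w))) + 5 / 28)%:E).
  apply: ge0_le_integral => //.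
  - by apply: emeasurable_funD => //; exact: mcosh.
  - by move=> w _; rewrite -EFinD lee_fin mul1r addr0; exact: abs_ge_exp.
rewrite I1 ge0_integralD//.
rewrite I2 addeC -leeBlDl//; apply: le_trans.
rewrite -EFinB lee_fin /gauss_const.
have -> : (2 ^+ 2 / 2 = 2^-1 * 4%:R :> R)%R by field.
rewrite expRM_natr expr1n mul1r.
by rewrite le_eqVlt; apply/orP; left; apply/eqP; field.
Qed.

Lemma gauss_abs_ge (a : nat -> R) (N : nat) :
  (gauss_const * Num.sqrt (\sum_(n < N) a n ^+ 2))%:E <=
  \int[P]_w `|\sum_(n < N) a n * g n w|%:E.
Proof.
set q := (\sum_(n < N) a n ^+ 2)%R.
have q0 : (0 <= q)%R by apply: sumr_ge0 => n _; exact: sqr_ge0.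
have [->|qn0] := eqVneq (Num.sqrt q) 0%R.
  by rewrite mulr0; apply: integral_ge0 => w _; rewrite lee_fin.
have s0 : (0 < Num.sqrt q)%R by rewrite lt_def qn0 sqrtr_ge0.
pose b n := (a n / Num.sqrt q)%R.
have b1 : (\sum_(n < N) b n ^+ 2 = 1)%R.
  rewrite /b; under eq_bigr do rewrite exprMn exprVn sqr_sqrtr//.
  by rewrite -mulr_suml divff//; apply: contra_neq qn0; rewrite -/q => ->; rewrite sqrtr0.
have -> : \int[P]_w `|\sum_(n < N) a n * g n w|%:E =
    (Num.sqrt q)%:E * \int[P]_w `|\sum_(n < N) b n * g n w|%:E.
  rewrite -ge0_integralZl//.
  - apply: eq_integral => w _; rewrite -EFinM; congr EFin.
    rewrite -[in RHS](gtr0_norm s0) -normrM mulr_sumr; congr `|_|%R.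
    by apply: eq_bigr => n _; rewrite mulrA /b mulrCA divff// mulr1.
  - by apply/measurable_EFinP; apply: measurableT_comp => //; exact: measurable_gauss_comb.
by rewrite mulrC EFinM lee_pmul2l// gauss_abs_ge1.
Qed.

End gaussian_abs.

(** * Strongly measurable functions and finite Gaussian sums *)

Section strong_measurability.
Import HBSimple.
Context d (Omega : measurableType d) (R : realType).

(** [vector_simple] with an arbitrary target: pairs of simple functions can be formed and composed
    with any map, without a sigma-algebra on the target. *)
Definition simple_map (A : Type) (f : Omega -> A) :=
  finite_set (range f) /\ forall a, measurable (f @^-1` [set a]).

Lemma simple_map_preimage (A : Type) (f : Omega -> A) (B : set A) :
  simple_map f -> measurable (f @^-1` B).
Proof.
move=> [ff mf].
have -> : f @^-1` B = \bigcup_(a in range f `&` B) f @^-1` [set a].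
  apply/seteqP; split => [x fx|x [a [_ Ba] /= ->//]].
  by exists (f x) => //; split => //; exists x.
by apply: fin_bigcup_measurable => [|a _]; [exact: finite_setIl | exact: mf].
Qed.

Lemma simple_map_comp (A B : Type) (f : Omega -> A) (u : A -> B) :
  simple_map f -> simple_map (u \o f).
Proof.
move=> sf; split; first by rewrite -(image_comp f u); apply: finite_image; exact: sf.1.
by move=> b; rewrite comp_preimage; exact: simple_map_preimage.
Qed.

Lemma simple_map_pair (A B : Type) (f : Omega -> A) (h : Omega -> B) :
  simple_map f -> simple_map h -> simple_map (fun t => (f t, h t)).
Proof.
move=> [ff mf] [fh mh]; split.
  apply: sub_finite_set (finite_setX ff fh) => _ [t _ <-].
  by split; exists t.
move=> [a b].
have -> : (fun t => (f t, h t)) @^-1` [set (a, b)] = f @^-1` [set a] `&` h @^-1` [set b].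
  by apply/seteqP; split => t /= [-> ->].
exact: measurableI.
Qed.

Context (Z : normedModType R).

Lemma strongly_measurable_lin (f h : Omega -> Z) (a : R) :
  strongly_measurable f -> strongly_measurable h ->
  strongly_measurable (fun t => a *: f t + h t).
Proof.
move=> [s [ss sf]] [r [sr rh]]; exists (fun k t => a *: s k t + r k t); split.
  move=> k.
  exact: (simple_map_comp (fun p : Z * Z => a *: p.1 + p.2) (simple_map_pair (ss k) (sr k))).
by move=> t; apply: cvgD; [apply: cvgZl_tmp; exact: sf | exact: rh].
Qed.

Lemma strongly_measurable_cst (z : Z) : strongly_measurable (fun _ : Omega => z).
Proof.
exists (fun _ _ => z); split => [k|t]; last exact: cvg_cst.
split; first by apply: sub_finite_set (finite_set1 z) => _ [t _ <-].
move=> w; have [->|wz] := eqVneq w z.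
  by rewrite (_ : _ @^-1` _ = setT)//; apply/seteqP.
rewrite (_ : _ @^-1` _ = set0)//; apply/seteqP; split => // t /= /esym/eqP.
by rewrite (negbTE wz).
Qed.

Lemma strongly_measurable_scale (phi : Omega -> R) (z : Z) :
  measurable_fun setT phi -> strongly_measurable (fun t => phi t *: z).
Proof.
move=> mphi.
have mphi' : measurable_fun setT (EFin \o phi) by exact/measurable_EFinP.
have [s sphi] := approximation_sfun measurableT mphi'.
exists (fun k t => s k t *: z); split => [k|t].
  have sk : simple_map (s k : Omega -> R).
    split; first exact: fimfunP.
    by move=> a; rewrite -[X in measurable X]setTI; exact: (measurable_funPT (s k)).
  exact: (simple_map_comp (fun x : R => x *: z) sk).
by have /fine_cvg sc := sphi t I; apply: cvgZr_tmp; exact: sc.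
Qed.

Lemma strongly_measurable_norm (f : Omega -> Z) :
  strongly_measurable f -> measurable_fun setT (fun t => `|f t|).
Proof.
move=> [s [ss sf]]; apply: (@measurable_fun_cvg _ _ _ setT (fun k t => `|s k t|)).
  move=> k _ B mB; rewrite setTI.
  exact: (simple_map_preimage B (simple_map_comp (fun z : Z => `|z|) (ss k))).
by move=> t _; apply: cvg_norm; exact: sf.
Qed.

End strong_measurability.

Section gauss_sum_finite.
Local Open Scope ereal_scope.
Context d (Omega : measurableType d) (R : realType) (P : probability Omega R).
Context (g : nat -> {RV P >-> R}) (Z : normedModType R).

Lemma integral_le_Lnorm2 (f : Omega -> R) : measurable_fun setT f ->
  \int[P]_t `|f t|%:E <= 'N[P]_2%:E[EFin \o f].
Proof.
move=> mf.
have := @hoelder _ _ _ P f (cst 1%R) 2 2 mf (measurable_cst _) _ _ _.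
rewrite (_ : EFin \o (f \* cst 1)%R = EFin \o f); last first.
  by apply/funext => t /=; rewrite mulr1.
rewrite Lnorm1 (_ : EFin \o cst 1%R = cst 1)// Lnorm_cst1.
rewrite (_ : P [set: Omega] `^ 2^-1 = 1) ?mule1; last first.
  by rewrite -(poweR1r 2^-1); congr (_ `^ _); exact: probability_setT.
by apply => //; lra.
Qed.

Lemma strongly_measurable_gauss_partial_sum (T : ell2 R ->b Z) N :
  strongly_measurable (gauss_partial_sum g T N).
Proof.
elim: N => [|N IH].
  rewrite (_ : gauss_partial_sum g T 0 = fun=> 0%R); first exact: strongly_measurable_cst.
  by apply/funext => t; rewrite /gauss_partial_sum big_ord0.
rewrite (_ : gauss_partial_sum g T N.+1 =
    fun t => (1 *: gauss_partial_sum g T N t + g N t *: T (e_ R N))%R).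
  apply: strongly_measurable_lin => //; apply: strongly_measurable_scale.
  exact: measurable_funP.
by apply/funext => t; rewrite /gauss_partial_sum big_ord_recr/= scale1r.
Qed.

(* The Gaussian series stops after N terms, so that its sum is, up to a null set,
   the N-th partial sum. *)
Lemma integral_gauss_partial_sum_le (T : ell2 R ->b Z) (N : nat) :
  (forall n, (N <= n)%N -> T (e_ R n) = 0%R) ->
  \int[P]_t `|gauss_partial_sum g T N t|%:E <= ell g T.
Proof.
move=> T0; set G := gauss_partial_sum g T N.
have Gk k : (N <= k)%N -> gauss_partial_sum g T k = G.
  move=> Nk; apply/funext => t; rewrite /G /gauss_partial_sum.
  rewrite -!(big_mkord xpredT (fun n => g n t *: T (e_ R n))%R).
  rewrite (big_cat_nat (leq0n N) Nk)/= [X in (_ + X)%R]big_nat_cond.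
  by rewrite [X in (_ + X)%R]big1 ?addr0// => n /andP[/andP[Nn _] _]; rewrite T0// scaler0.
have sG : strongly_measurable G by exact: strongly_measurable_gauss_partial_sum.
have Gsum : is_gauss_sum g T G.
  split => //; apply: cvg_near_cst; exists N => // k Nk; rewrite Gk//.
  rewrite /L2_norm (_ : (EFin \o _) = cst 0); first by rewrite Lnorm0.
  by apply/funext => t /=; rewrite subrr normr0.
(* [G] witnesses that the series has a sum, so [xget] returns one. *)
have [sf fsum] : is_gauss_sum g T (gauss_sum g T).
  exact: (@xgetI _ _ [set f | is_gauss_sum g T f] G Gsum).
rewrite /ell; set f := gauss_sum g T in sf fsum *.
have sGf : strongly_measurable (fun t => G t - f t)%R.
  rewrite (_ : (fun t => _) = (fun t => -1 *: f t + G t)%R).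
    exact: strongly_measurable_lin.
  by apply/funext => t; rewrite scaleN1r addrC.
have mGf := strongly_measurable_norm sGf.
have mf := strongly_measurable_norm sf.
have Gf0 : L2_norm P (fun t => G t - f t)%R = 0.
  have := fsum; move=> /cvg_lim <-//; apply/esym/cvg_lim => //.
  by apply: cvg_near_cst; exists N => // k Nk; rewrite Gk.
have int0 : \int[P]_t `|G t - f t|%:E = 0.
  apply/le_anti; rewrite integral_ge0 ?andbT//.
  rewrite -Gf0; have := integral_le_Lnorm2 mGf.
  by under eq_integral do rewrite normr_id.
apply: (@le_trans _ _ (\int[P]_t (`|G t - f t|%:E + `|f t|%:E))).
  apply: ge0_le_integral => //.
  - by apply/measurable_EFinP; exact: strongly_measurable_norm.
  - by apply: emeasurable_funD; exact/measurable_EFinP.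
  - move=> t _; rewrite -EFinD lee_fin.
    by rewrite -[in leLHS](subrK (f t) (G t)) ler_normD.
rewrite ge0_integralD//; try exact/measurable_EFinP.
rewrite int0 add0e; apply: le_trans (integral_le_Lnorm2 mf).
rewrite le_eqVlt; apply/orP; left; apply/eqP.
by apply: eq_integral => t _; rewrite normr_id.
Qed.

End gauss_sum_finite.

(** * The dual norm of l2 in coordinates *)

Section dual_of_ell2.
Context (R : realType).
Local Notation ell2 := (ell2 R).

Lemma cauchy_schwarz (N : nat) (a b : 'I_N -> R) :
  \sum_n a n * b n <= Num.sqrt (\sum_n a n ^+ 2) * Num.sqrt (\sum_n b n ^+ 2).
Proof.
set A := \sum_n a n ^+ 2; set B := \sum_n b n ^+ 2.
have A0 : 0 <= A by apply: sumr_ge0 => n _; exact: sqr_ge0.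
have B0 : 0 <= B by apply: sumr_ge0 => n _; exact: sqr_ge0.
have [a0|aneq] := eqVneq A 0.
  rewrite big1 ?mulr_ge0 ?sqrtr_ge0// => n _.
  have : a n ^+ 2 <= A by rewrite /A (bigD1 n)//= lerDl sumr_ge0// => m _; exact: sqr_ge0.
  by rewrite a0 real_exprn_even_le0 ?num_real//= => /eqP ->; rewrite mul0r.
have Ap : 0 < A by rewrite lt_def aneq.
rewrite -sqrtrM//; set S := \sum_n a n * b n.
apply: (le_trans (ler_norm _)); rewrite -sqrtr_sqr; apply: ler_wsqrtr.
have : 0 <= \sum_n (S * a n - A * b n) ^+ 2 by apply: sumr_ge0 => n _; exact: sqr_ge0.
have -> : \sum_n (S * a n - A * b n) ^+ 2 = A * (A * B - S ^+ 2).
  transitivity (\sum_n (S ^+ 2 * a n ^+ 2 + (- 2 * S * A) * (a n * b n) + A ^+ 2 * b n ^+ 2)).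
    by apply: eq_bigr => n _; ring.
  by rewrite !big_split/= -!mulr_sumr -/A -/B -/S; ring.
by rewrite pmulr_rge0// subr_ge0.
Qed.

(** Truncations converge in norm and [w] is continuous, so finite Cauchy-Schwarz suffices. The dual
    norm is thereby reduced to l2 norms of coordinates, which Gaussian averages detect. *)
Lemma dual_ell2_le (w : dual ell2) (l : R) :
  (forall N, Num.sqrt (\sum_(n < N) (w (e_ R n)) ^+ 2) <= l) -> `|w| <= l.
Proof.
move=> wl; have l0 : 0 <= l by exact: le_trans (sqrtr_ge0 _) (wl 0%N).
apply: opnorm_le => // h.
have wc : w (trunc n h) @[n --> \oo] --> w h.
  by apply: continuous_cvg; [exact: (bopP w).2 | exact: trunc_cvg].
have wc' : (fun n => `|w (trunc n h)| : R) @ \oo --> (`|w h| : R) by exact: cvg_norm.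
rewrite -(cvg_lim _ wc')//; apply: limr_le; first exact: cvgP wc'.
apply: nearW => N.
have E (s : R) : s * w (trunc N h) = \sum_(n < N) (s * h n) * w (e_ R n).
  rewrite /trunc linear_sum mulr_sumr; apply: eq_bigr => n _.
  by rewrite linearZ mulrA.
have B (s : R) : s ^+ 2 = 1 -> s * w (trunc N h) <= l * `|h|.
  move=> s1; rewrite E; apply: (le_trans (cauchy_schwarz _ _)); rewrite mulrC.
  rewrite ler_pM ?sqrtr_ge0//.
  under eq_bigr do rewrite exprMn s1 mul1r.
  apply: (@le_trans _ _ (Num.sqrt (`|h| ^+ 2))); last by rewrite sqrtr_sqr normr_id.
  by apply: ler_wsqrtr; exact: ell2_sum_sqr_le.
have := B 1; have := B (-1); rewrite !mulN1r !mul1r sqrrN expr1n => /(_ erefl) b1 /(_ erefl) b2.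
by rewrite ler_norml lerNl b1 b2.
Qed.

End dual_of_ell2.

(** * The theorem *)

Section gap_inequality.
Context (R : realType).
Local Notation ell2 := (ell2 R).

Lemma truncation (N : nat) : exists t : ell2 ->b ell2, t =1 trunc N.
Proof.
have tle (h : ell2) : `|trunc N h| <= 1 * `|h| by rewrite mul1r norm_trunc_le.
pose tl := GRing.isLinear.Build R ell2 ell2 *:%R (trunc N) (@trunc_linear R N).
pose tL : {linear ell2 -> ell2} := HB.pack (trunc N : ell2 -> ell2) tl.
have mt : (tL : ell2 -> ell2) \in @is_bop R ell2 ell2.
  by exact: (@mem_bop _ _ _ tL 1 tle).
by exists (Bop mt).
Qed.

Lemma trunc_e N n : trunc N (e_ R n) = if (n < N)%N then e_ R n else 0.
Proof.
apply: ell2P => k; rewrite truncE !(fun_if (fun h : ell2 => h k)) e_E.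
by have [->//|_] := eqVneq k n; case: ifP; case: ifP.
Qed.

Context d (Omega : measurableType d) (P : probability Omega R).
Context (g : nat -> {RV P >-> R}) (X : normedModType R).
Hypothesis std : standard_gaussian_sequence g.
Context (E : submodClosed X) (T : ell2 ->b subsp E) (K C : R).
Hypothesis gapK : forall T : ell2 ->b X, finite_rank T -> (ell g T <= K%:E * pi1 (adjoint T))%E.
Hypothesis K0 : 0 <= K.
Hypothesis TC : (pi1 (bop_comp (adjoint T) (quotient_map E)) <= C%:E)%E.

(** Truncation makes the Gaussian series stop, so that [ell] dominates the mean norm of an explicit
    finite sum; being a contraction, it does not increase the 1-summing norm of the adjoint. *)
Lemma gauss_partial_sum_le (N : nat) :
  (\int[P]_t `|\sum_(n < N) g n t *: T (e_ R n)|%:E <= (K * C)%:E)%E.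
Proof.
have [tr trE] := truncation N.
pose TN : ell2 ->b X := bop_comp (bop_comp (@Defs.incl R X E) T) tr.
have TNE h : TN h = val (T (trunc N h)) by rewrite -trE.
have C0 : 0 <= C by rewrite -lee_fin (le_trans (pi1_ge0 _) TC).
have TNfin : finite_rank TN.
  exists [seq val (T (e_ R n)) | n <- iota 0 N] => h; exists (fun n => h n).
  rewrite TNE /trunc linear_sum size_map size_iota.
  rewrite (raddf_sum (val : subsp E -> X)).
  apply: eq_bigr => n _; rewrite linearZ (nth_map 0%N) ?size_iota// nth_iota//.
have TN0 n : (N <= n)%N -> TN (e_ R n) = 0.
  by move=> Nn; rewrite TNE trunc_e ltnNge Nn/= linear0.
have piTN : (pi1 (adjoint TN) <= C%:E)%E.
  apply: pi1_le => // s; apply: le_trans (pi1_sum_le s TC).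
  apply: ler_sum => f _; apply: opnorm_le_ball => h h1.
  rewrite -[adjoint TN f h]/(f (TN h)) TNE.
  apply: (le_trans (bop_le (bop_comp (adjoint T) (quotient_map E) f) (trunc N h))).
  by rewrite ler_piMr// (le_trans (norm_trunc_le _ _)).
have := integral_gauss_partial_sum_le g TN0 => H.
rewrite EFinM; apply: (@le_trans _ _ (K%:E * pi1 (adjoint TN))%E); last first.
  by rewrite lee_wpmul2l// lee_fin.
apply: le_trans (gapK TNfin); apply: le_trans H.
rewrite le_eqVlt; apply/orP; left; apply/eqP; apply: eq_integral => t _; congr EFin.
rewrite -[`|\sum_(n < N) _|]/(`|val (\sum_(n < N) g n t *: T (e_ R n))|).
rewrite (raddf_sum (val : subsp E -> X)) /gauss_partial_sum; congr `|_|.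
by apply: eq_bigr => n _; rewrite TNE trunc_e ltn_ord.
Qed.

Lemma sum_sqrt_le (s : seq (dual (subsp E))) (N : nat) :
  \sum_(u <- s) Num.sqrt (\sum_(n < N) (adjoint T u (e_ R n)) ^+ 2) <=
  K * C * weak_l1_norm s / gauss_const R.
Proof.
have c0 := gauss_const_gt0 R.
rewrite ler_pdivlMr// mulrC mulr_sumr -lee_fin -sumEFin.
have mu (u : dual (subsp E)) : measurable_fun setT
    (fun t => `|\sum_(n < N) adjoint T u (e_ R n) * g n t|%:E).
  apply/measurable_EFinP; apply: measurableT_comp => //.
  exact: (measurable_gauss_comb g (fun n => adjoint T u (e_ R n))).
apply: (@le_trans _ _ (\sum_(u <- s)
    \int[P]_t `|\sum_(n < N) adjoint T u (e_ R n) * g n t|%:E)%E).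
  by apply: lee_sum => u _; exact: (gauss_abs_ge std (fun n => adjoint T u (e_ R n))).
rewrite -ge0_integral_sum//.
(* At a fixed [t] the inner sums are the values of the functionals [u] at a single vector of [E], so
   [eval_sum_le] applies pointwise. *)
apply: (@le_trans _ _ (\int[P]_t
    ((weak_l1_norm s)%:E * `|\sum_(n < N) g n t *: T (e_ R n)|%:E))%E).
  apply: ge0_le_integral => //.
  - by move=> t _; apply: sume_ge0 => u _; rewrite lee_fin.
  - by apply: emeasurable_sum.
  - apply: emeasurable_funM => //; apply/measurable_EFinP.
    exact: (strongly_measurable_norm (strongly_measurable_gauss_partial_sum g T N)).
  - move=> t _; rewrite sumEFin -EFinM lee_fin mulrC.
    apply: le_trans (eval_sum_le s _); rewrite le_eqVlt; apply/orP; left; apply/eqP.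
    apply: eq_bigr => u _; rewrite linear_sum; congr `|_|; apply: eq_bigr => n _.
    by rewrite linearZ mulrC.
rewrite ge0_integralZl//.
- rewrite [in leRHS]mulrC EFinM lee_wpmul2l ?lee_fin ?weak_l1_ge0//.
  exact: gauss_partial_sum_le.
- apply/measurable_EFinP.
  exact: (strongly_measurable_norm (strongly_measurable_gauss_partial_sum g T N)).
- by rewrite lee_fin weak_l1_ge0.
Qed.

(** The dual norm of [adjoint T u] is at most the supremum over [N] of the l2 norms [sg u N]. These
    increase with [N], so the limit can be taken after summing over the finite list [s], and the
    bound of [sum_sqrt_le] is uniform in [N]. *)
Lemma gap_pi1_le : (pi1 (adjoint T) <= (K / gauss_const R * C)%:E)%E.
Proof.
have C0 : 0 <= C by rewrite -lee_fin (le_trans (pi1_ge0 _) TC).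
have c0 := gauss_const_gt0 R.
apply: pi1_le; first by rewrite mulr_ge0// divr_ge0// ltW.
move=> s.
pose sg (u : dual (subsp E)) N := Num.sqrt (\sum_(n < N) (adjoint T u (e_ R n)) ^+ 2).
set D := _ * weak_l1_norm s.
have sgD N : \sum_(u <- s) sg u N <= D.
  by apply: le_trans (sum_sqrt_le s N) _; rewrite /D; rewrite mulrAC [K / _ * C]mulrAC.
pose l u := sup (range (sg u)).
have lub u : u \in s -> has_sup (range (sg u)).
  move=> us; split; first by exists (sg u 0%N), 0%N.
  exists D => _ [N _ <-]; apply: le_trans (sgD N).
  rewrite (big_rem u us)/= lerDl sumr_ge0// => v _; exact: sqrtr_ge0.
have sgc u : u \in s -> sg u @ \oo --> l u.
  move=> us; apply: nondecreasing_cvgn.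
    move=> N M NM; apply: ler_wsqrtr.
    rewrite -!(big_mkord xpredT (fun n => (adjoint T u (e_ R n)) ^+ 2)).
    by rewrite (big_cat_nat (leq0n N) NM)/= lerDl sumr_ge0// => n _; exact: sqr_ge0.
  by case: (lub u us) => _ [M HM]; exists M.
have H : (fun N => \sum_(u <- s) sg u N) @ \oo --> \sum_(u <- s) l u.
  have sub : {subset s <= s} by [].
  elim: {1 3 4}s sub => [|u t IH] ts.
    by under eq_fun do rewrite big_nil; rewrite big_nil; exact: cvg_cst.
  under eq_fun do rewrite big_cons; rewrite big_cons; apply: cvgD.
    by apply: sgc; apply: ts; rewrite mem_head.
  by apply: IH => v vt; apply: ts; rewrite inE vt orbT.
apply: (@le_trans _ _ (\sum_(u <- s) l u)).
  rewrite big_seq [leRHS]big_seq; apply: ler_sum => u us.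
  apply: dual_ell2_le => N; apply: ub_le_sup; first by case: (lub u us).
  by exists N.
rewrite -(cvg_lim _ H)//; apply: limr_le; first exact: cvgP H.
exact: nearW.
Qed.

End gap_inequality.

(** * Extension of operators in Gamma_1 *)

Section extension_of_Gamma1.
Context (R : realType) (X : normedModType R).
Local Notation ell2 := (ell2 R).

Lemma finite_sum_operator (V : normedModType R) (N : nat) (x : nat -> V) :
  exists T : ell2 ->b V, forall h, T h = \sum_(n < N) h n *: x n.
Proof.
pose t (h : ell2) := \sum_(n < N) h n *: x n.
have tlin : linear t.
  move=> a h k; rewrite /t scaler_sumr -big_split/=; apply: eq_bigr => n _.
  by rewrite -[(_ + _) (val n)]/(a * h n + k n) scalerDl scalerA.
have tle h : `|t h| <= (\sum_(n < N) `|x n|) * `|h|.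
  apply: (le_trans (ler_norm_sum _ _ _)); rewrite mulr_suml; apply: ler_sum => n _.
  by rewrite normrZ mulrC ler_wpM2l// ell2_coord_le.
pose tl := GRing.isLinear.Build R ell2 V *:%R t tlin.
pose tL : {linear ell2 -> V} := HB.pack t tl.
have mt : (tL : ell2 -> V) \in @is_bop R ell2 V by exact: (@mem_bop _ _ _ tL _ tle).
by exists (Bop mt).
Qed.

Lemma gamma1_fin_num (E : normedModType R) (S : E ->b ell2) : Gamma1 S ->
  (0 <= fine (gamma1 S)) /\ (fine (gamma1 S))%:E = gamma1 S.
Proof.
move=> [c Sc].
have g0 : (0 <= gamma1 S)%E.
  apply/ereal_infP => _ [_ [d [Y [nu [A [B [_ ->]]]]]] <-].
  by rewrite lee_fin mulr_ge0.
have gc : (gamma1 S <= c%:E)%E by apply: ereal_inf_lbound; exists c.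
split; first exact: fine_ge0.
by rewrite fineK// ge0_fin_numE// (le_lt_trans gc)// ltry.
Qed.

(** Trace duality for each factorization, then the infimum over all of them; [C = 0] is set apart
    because the infimum is reached after division by [C]. *)
Lemma trace_le_gamma1 (V : normedModType R) (S : V ->b ell2) (T : ell2 ->b V)
    (N : nat) (x : nat -> V) (C : R) : Gamma1 S ->
  (forall h, T h = \sum_(n < N) h n *: x n) -> (pi1 (adjoint T) <= C%:E)%E ->
  \sum_(n < N) S (x n) n <= fine (gamma1 S) * C.
Proof.
move=> GS TE TC; have C0 : 0 <= C by rewrite -lee_fin (le_trans (pi1_ge0 _) TC).
have fact c : L1_factorization S c -> \sum_(n < N) S (x n) n <= c * C.
  move=> [d [Y [nu [A [B [-> ->]]]]]].
  exact: trace_duality TE TC.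
have [[c Sc] [g0 gE]] := (GS, gamma1_fin_num GS).
have [C00|Cn0] := eqVneq C 0; first by have := fact _ Sc; rewrite C00 !mulr0.
have Cp : 0 < C by rewrite lt_def Cn0.
rewrite -ler_pdivrMr// -lee_fin gE; apply/ereal_infP => _ [c' Sc' <-].
by rewrite lee_fin ler_pdivrMr// fact.
Qed.

(* The hypothesis on [K] is the inequality between the 1-summing norms; by trace
   duality it extends the trace form of [S] from the tensors over [E] to those
   over [X]. *)
Lemma Gamma1_extension (E : submodClosed X) (K : R) : 0 <= K ->
  (forall (T : ell2 ->b subsp E) (C : R),
    (pi1 (bop_comp (adjoint T) (quotient_map E)) <= C%:E)%E ->
    (pi1 (adjoint T) <= (K * C)%:E)%E) ->
  forall S : subsp E ->b ell2, Gamma1 S ->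
  exists S' : X ->b ell2, [/\ Gamma1 S', forall x : subsp E, S' (val x) = S x
    & (gamma1 S' <= (4 * K)%:E * gamma1 S)%E].
Proof.
move=> K0 HK S GS; have [g0 gE] := gamma1_fin_num GS.
set gam := fine (gamma1 S) in g0 gE.
have Kg0 : 0 <= K * gam by rewrite mulr_ge0.
have S_le N (x : nat -> subsp E) c :
    tensor_cost (fun h : ell2 => \sum_(n < N) h n *: val (x n)) c ->
    \sum_(n < N) S (x n) n <= K * gam * c.
  move=> xc; have [T TE] := finite_sum_operator N x.
  have Tc : tensor_cost (fun h => val (T h)) c.
    rewrite (_ : (fun h => _) = (fun h : ell2 => \sum_(n < N) h n *: val (x n)))//.
    apply/funext => h; rewrite TE (raddf_sum (val : subsp E -> X)).
    by apply: eq_bigr => n _.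
  have := trace_le_gamma1 GS TE (HK _ _ (pi1_adjoint_tensor_le Tc)).
  by rewrite -/gam mulrA [gam * K]mulrC.
have [m [mC mS]] := extension_family (bop_linear S) Kg0 S_le.
have [s [s2 /(_ _ _ mC)[c [clin cle cm]]]] := ball_family_representation X.
have [A [A_le AE]] := L1_analysis (mulr_ge0 (ler0n R 2) Kg0) clin cle.
have [B [B_le BE]] := L1_synthesis s2.
have fact : L1_factorization (bop_comp B A) (`|A| * `|B|).
  by exists _, _, (@counting nat R), A, B.
exists (bop_comp B A); split.
- by exists (`|A| * `|B|).
- move=> x; apply: ell2P => n; rewrite -mS.
  have H := BE (A (val x)) n; have H' := cm (val x) n.
  rewrite -[LHS]/(B (A (val x)) n) -(cvg_lim _ H)// -(cvg_lim _ H')//.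
  by congr (lim (_ @ \oo)); apply/funext => N; apply: eq_bigr => i _; rewrite AE.
- apply: (@le_trans _ _ (`|A| * `|B|)%:E).
    by apply: ereal_inf_lbound; exists (`|A| * `|B|).
  (* In the factor 4, one 2 is the sum of the geometric series in the coefficients and the other
     bounds the norms in the dictionary. *)
  rewrite -gE -EFinM lee_fin (_ : 4 * K * gam = 2 * (K * gam) * 2); last by ring.
  by apply: ler_pM.
Qed.

End extension_of_Gamma1.

Theorem theorem2p1 (R : realType) (d : measure_display)
    (Omega : measurableType d) (P : probability Omega R)
    (g : nat -> {RV P >-> R}) (X : completeNormedModType R) :
  standard_gaussian_sequence g -> GAP g X ->
  exists K : R,
    (forall E : submodClosed X, closed [set` E] ->
      forall T : ell2 R ->b subsp E, finite_rank T ->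
        (pi1 (adjoint T) <=
         K%:E * pi1 (bop_comp (adjoint T) (quotient_map E)))%E) /\
    (forall E : submodClosed X, closed [set` E] ->
      forall S : subsp E ->b ell2 R, Gamma1 S ->
        exists S' : X ->b ell2 R,
          [/\ Gamma1 S',
              forall x : subsp E, S' (val x) = S x
            & (gamma1 S' <= K%:E * gamma1 S)%E]).
Proof.
move=> std [K0 gap].
(* The constant in [GAP] is an arbitrary real; the maximum makes it positive. *)
pose K1 := Num.max K0 1.
have K10 : 0 < K1 by rewrite lt_max ltr01 orbT.
have gap1 (T : ell2 R ->b X) : finite_rank T -> (ell g T <= K1%:E * pi1 (adjoint T))%E.
  move=> Tfin; apply: (le_trans (gap T Tfin)); apply: lee_wpmul2r; first exact: pi1_ge0.
  by rewrite lee_fin le_max lexx.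
pose K := K1 / gauss_const R.
have Kp : 0 < K by rewrite divr_gt0// gauss_const_gt0.
have ineq (E : submodClosed X) (T : ell2 R ->b subsp E) (C : R) :
    (pi1 (bop_comp (adjoint T) (quotient_map E)) <= C%:E)%E ->
    (pi1 (adjoint T) <= (K * C)%:E)%E.
  by move=> TC; exact: (gap_pi1_le std gap1 (ltW K10) TC).
(* The inequality holds with [K]; the extension costs the factor 4, and the larger constant serves
   both statements. *)
exists (4 * K); split => [E _ T _|E _ S GS]; last first.
  by apply: (Gamma1_extension (ltW Kp) _ GS) => T C; exact: ineq.
have p0 := pi1_ge0 (bop_comp (adjoint T) (quotient_map E)).
move: p0 (ineq E T); case: (pi1 (bop_comp _ _)) => [C| |//] C0 /=.
  move=> /(_ C (lexx _))/le_trans; apply; rewrite -EFinM lee_fin.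
  rewrite lee_fin in C0; rewrite ler_wpM2r//.
  by rewrite ler_peMl ?(ltW Kp)//; lra.
(* The case of an infinite 1-summing norm on the right: a positive constant keeps the product
   infinite. *)
have K4 : 0 < 4 * K by exact: mulr_gt0.
by move=> _; rewrite gt0_muley ?lte_fin//; exact: leey.
Qed.
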